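(* Let $0<\alpha<1$ and $0\leqslant\beta<1$, and consider the difference equation $x_{n+1}=\alpha+\beta x_{n-1}+\frac{x_{n-1}}{x_n}$, $n=0,1,2,\ldots$, with positive initial conditions $x_{-1},x_0$, together with its associated planar map $T(y,z)=\left(z,\ \alpha+\beta y+\frac{y}{z}\right)$, where $y=x_{n-1}$, $z=x_n$. Put $\bar x=\frac{1+\alpha}{1-\beta}$, so that $(\bar x,\bar x)$ is the saddle fixed point of $T$. Define $$\theta=\sqrt{1+4\bar x+4\beta\bar x^2},\qquad \lambda_1=\frac{-1-\theta}{2\bar x},\qquad \lambda_2=\frac{-1+\theta}{2\bar x},$$ $$a_2=\frac{1+\theta+2\beta\bar x}{\theta(\theta+1)(\lambda_1^2-\lambda_2)\bar x},$$ $$a_3=\frac{a_2}{(\lambda_1^3-\lambda_2)\bar x}\left[\lambda_2-\lambda_1^2-\frac{1+2\beta\bar x}{\theta\bar x}\left(\frac1{\lambda_1}+\frac{\lambda_1}{\lambda_2}\right)-\frac{\lambda_1}{\lambda_2\bar x}\right],$$ $$\gamma_1=-\frac{1+\beta\bar x}{\theta},\qquad \gamma_2=\frac{\theta-1}{2\theta},\qquad \gamma_3=\frac{\theta+1}{2\theta},$$ and $$U(x,y)=\gamma_1(x-\bar x)-\gamma_2(y-\bar x)+a_2\left[\gamma_1(x-\bar x)+\gamma_3(y-\bar x)\right]^2+a_3\left[\gamma_1(x-\bar x)+\gamma_3(y-\bar x)\right]^3 .$$ Then the local unstable manifold of the equation corresponding to the saddle point $\bar x$ has the asymptotic equation $U(x,\tilde\varphi(x))=0$.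 That is, let $\tilde\varphi$ be the smooth function defined near $\bar x$ and determined by $\tilde\varphi(\bar x)=\bar x$ and $U(x,\tilde\varphi(x))=0$. Then, in a neighborhood of $(\bar x,\bar x)$, the local unstable manifold of $T$ at $(\bar x,\bar x)$ is the graph $\{(x,\omega(x))\}$ of a smooth function $\omega$ defined near $\bar x$ with $$\omega(x)=\tilde\varphi(x)+O\left(|x-\bar x|^4\right)\quad\text{as } x\to\bar x .$$
   Context: The map $T$ acts on $(0,\infty)^2$; it is a diffeomorphism onto its image near $(\bar x,\bar x)$, and $(\bar x,\bar x)$ is its unique fixed point. The numbers $\lambda_1,\lambda_2$ are the eigenvalues of $DT(\bar x,\bar x)$; for $0<\alpha<1$ one has $|\lambda_1|>1$ and $|\lambda_2|<1$, so the fixed point is a saddle. For a (sufficiently small) neighborhood $\mathcal N$ of a fixed point $p$ of a diffeomorphism $T$, the local unstable manifold is $W^u(p,\mathcal N)=\{\mathbf x\in\mathcal N:\ T^{-n}(\mathbf x)\in\mathcal N\text{ for all }n\geqslant 0,\ T^{-n}(\mathbf x)\to p\text{ as }n\to\infty\}$. In the plane, a point $(x,y)$ corresponds to $(x_{n-1},x_n)$. *)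

(* Defs.v *)
From Stdlib Require Import Reals Lra.
From Coquelicot Require Import Coquelicot.
Open Scope R_scope.

(* The difference equation is x_{n+1} = rhs alpha beta x_{n-1} x_n. *)
Definition rhs (alpha beta u v : R) : R := alpha + beta * u + u / v.

(* A point (y, z) stands for (x_{n-1}, x_n). The map is only meaningful on the
   open quadrant (0,oo)^2; its values elsewhere are never used below. *)
Definition T (alpha beta : R) (p : R * R) : R * R :=
  (snd p, rhs alpha beta (fst p) (snd p)).

Definition quadrant (p : R * R) : Prop := 0 < fst p /\ 0 < snd p.

Definition xbar (alpha beta : R) : R := (1 + alpha) / (1 - beta).

Definition pbar (alpha beta : R) : R * R := (xbar alpha beta, xbar alpha beta).

Lemma T_pbar (alpha beta : R) :
  0 < alpha -> beta < 1 -> T alpha beta (pbar alpha beta) = pbar alpha beta.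
Proof.
intros ha hb; unfold T, pbar, rhs, xbar; simpl; f_equal; field; lra.
Qed.

Lemma T_inj (alpha beta : R) (p q : R * R) :
  0 <= beta -> quadrant p -> quadrant q ->
  T alpha beta p = T alpha beta q -> p = q.
Proof.
destruct p as [y z], q as [y' z']; unfold quadrant, T, rhs; simpl.
intros hb [hy hz] [hy' hz'] e; injection e as e1 e2; subst z'; f_equal.
assert (hi : 0 < / z) by now apply Rinv_0_lt_compat.
apply (Rmult_eq_reg_r (beta + / z)); [unfold Rdiv in e2; lra | lra].
Qed.

(* W^u(p, N). The sequence u is the backward orbit u n = F^{-n}(q); it is unique
   as soon as F is injective on N, which for T holds whenever N lies in the
   quadrant (T_inj). *)
Definition local_unstable (F : R * R -> R * R) (p : R * R) (N : R * R -> Prop)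
    (q : R * R) : Prop :=
  N q /\
  exists u : nat -> R * R,
    u 0%nat = q /\
    (forall n, F (u (S n)) = u n) /\
    (forall n, N (u n)) /\
    filterlim u eventually (locally p).

Definition smooth_near (f : R -> R) (a : R) : Prop :=
  locally a (fun x => forall n, ex_derive_n f n x).

Definition theta (alpha beta : R) : R :=
  let x := xbar alpha beta in sqrt (1 + 4 * x + 4 * beta * x ^ 2).

Definition lambda1 (alpha beta : R) : R :=
  (- 1 - theta alpha beta) / (2 * xbar alpha beta).

Definition lambda2 (alpha beta : R) : R :=
  (- 1 + theta alpha beta) / (2 * xbar alpha beta).

Definition a2 (alpha beta : R) : R :=
  let x := xbar alpha beta in
  let th := theta alpha beta in
  let l1 := lambda1 alpha beta in
  let l2 := lambda2 alpha beta in
  (1 + th + 2 * beta * x) / (th * (th + 1) * (l1 ^ 2 - l2) * x).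

Definition a3 (alpha beta : R) : R :=
  let x := xbar alpha beta in
  let th := theta alpha beta in
  let l1 := lambda1 alpha beta in
  let l2 := lambda2 alpha beta in
  a2 alpha beta / ((l1 ^ 3 - l2) * x) *
  (l2 - l1 ^ 2 - (1 + 2 * beta * x) / (th * x) * (1 / l1 + l1 / l2)
   - l1 / (l2 * x)).

Definition gamma1 (alpha beta : R) : R :=
  - ((1 + beta * xbar alpha beta) / theta alpha beta).

Definition gamma2 (alpha beta : R) : R :=
  (theta alpha beta - 1) / (2 * theta alpha beta).

Definition gamma3 (alpha beta : R) : R :=
  (theta alpha beta + 1) / (2 * theta alpha beta).

Definition U (alpha beta x y : R) : R :=
  let c := xbar alpha beta in
  let g1 := gamma1 alpha beta in
  let g2 := gamma2 alpha beta in
  let g3 := gamma3 alpha beta in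
  g1 * (x - c) - g2 * (y - c)
  + a2 alpha beta * (g1 * (x - c) + g3 * (y - c)) ^ 2
  + a3 alpha beta * (g1 * (x - c) + g3 * (y - c)) ^ 3.

Definition U_solution (alpha beta : R) (phi : R -> R) : Prop :=
  let c := xbar alpha beta in
  smooth_near phi c /\ phi c = c /\ locally c (fun x => U alpha beta x (phi x) = 0).

(* Main.v *)
Require Import Defs.
From Stdlib Require Import Reals Lra Lia Ranalysis5.
From Stdlib Require Import ClassicalEpsilon FunctionalExtensionality.
From Coquelicot Require Import Coquelicot.
Open Scope R_scope.

(* The unstable manifold is parametrized by a power series g with g(0) = xbar and
   T(g(t), g(l1 t)) = (g(l1 t), g(l1^2 t)), l1 = lambda1. Comparing coefficients,
   xbar (l1^k - l1) (l1^k - l2) a_k is a quadratic expression in the earlier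
   coefficients; since |l1| > 1, all |a_k| are bounded by a_1 once a_1 is small,
   so the series converges. Inverting g near 0 gives the smooth function
   omega = g o (l1 .) o g^{-1}. Points with a backward orbit staying near the
   fixed point lie on its graph because T contracts the vertical distance to the
   graph by a factor close to l2 < 1. The cubic curve U = 0 is rational in the
   parameter w = gamma1 (x - xbar) + gamma3 (y - xbar), which yields phi, and
   U(g(t), g(l1 t)) = O(t^4) is the vanishing of three coefficients, an identity
   in l1, l2 because xbar = -1/(l1 + l2), beta = l1 + l2 - l1 l2 and
   theta = xbar (l2 - l1). *)

(** * Smooth functions and the inverse function theorem *)

(** Derivatives are existential witnesses instead of iterates of [Derive], so the rules for sums,
    products, inverses and compositions are plain inductions on the order. *)
Fixpoint Ck (D : R -> Prop) (n : nat) (f : R -> R) : Prop :=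
  match n with
  | O => True
  | S m => exists f' : R -> R,
      (forall x, D x -> is_derive f x (f' x)) /\ Ck D m f'
  end.

Definition smooth_on (D : R -> Prop) (f : R -> R) : Prop := forall n, Ck D n f.

Lemma Ck_pred (D : R -> Prop) (n : nat) (f : R -> R) : Ck D (S n) f -> Ck D n f.
Proof.
revert f; induction n as [|n IH]; intros f H; [exact I|].
destruct H as [f' [Hf Hf']]; exists f'; split; [exact Hf|now apply IH].
Qed.

Lemma Ck_subset (D E : R -> Prop) (n : nat) (f : R -> R) :
  (forall x, E x -> D x) -> Ck D n f -> Ck E n f.
Proof.
intros HED; revert f; induction n as [|n IH]; intros f H; [exact I|].
destruct H as [f' [Hf Hf']]; exists f'; split; auto.
Qed.

Lemma Ck_ext (D : R -> Prop) (n : nat) (f g : R -> R) :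
  open D -> (forall x, D x -> f x = g x) -> Ck D n f -> Ck D n g.
Proof.
intros HD Efg; destruct n as [|n]; intros Hf; [exact I|].
destruct Hf as [f' [Hf Hf']]; exists f'; split; [|exact Hf'].
intros x Dx; apply (is_derive_ext_loc f); [|now apply Hf].
apply (filter_imp D); [exact Efg|now apply HD].
Qed.

Lemma Ck_const (D : R -> Prop) (n : nat) (k : R) : Ck D n (fun _ => k).
Proof.
revert k; induction n as [|n IH]; intros k; [exact I|].
exists (fun _ => 0); split; [|apply IH].
intros x _; exact (is_derive_const k x).
Qed.

Lemma Ck_id (D : R -> Prop) (n : nat) : Ck D n (fun x => x).
Proof.
destruct n as [|n]; [exact I|].
exists (fun _ => 1); split; [|apply Ck_const].
intros x _; exact (is_derive_id x).
Qed.

Lemma Ck_plus (D : R -> Prop) (n : nat) (f g : R -> R) :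
  Ck D n f -> Ck D n g -> Ck D n (fun x => f x + g x).
Proof.
revert f g; induction n as [|n IH]; intros f g Hf Hg; [exact I|].
destruct Hf as [f' [Hf Hf']], Hg as [g' [Hg Hg']].
exists (fun x => f' x + g' x); split; [|now apply IH].
intros x Dx; now apply (is_derive_plus f g); auto.
Qed.

Lemma Ck_mult (D : R -> Prop) (n : nat) (f g : R -> R) :
  Ck D n f -> Ck D n g -> Ck D n (fun x => f x * g x).
Proof.
revert f g; induction n as [|n IH]; intros f g Hf Hg; [exact I|].
pose proof (Ck_pred _ _ _ Hf) as Hf0; pose proof (Ck_pred _ _ _ Hg) as Hg0.
destruct Hf as [f' [Hf Hf']], Hg as [g' [Hg Hg']].
exists (fun x => f' x * g x + f x * g' x); split.
- intros x Dx.
  apply (is_derive_mult f g x (f' x) (g' x)); auto; intros; apply Rmult_comm.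
- apply Ck_plus; now apply IH.
Qed.

Lemma Ck_comp (D E : R -> Prop) (n : nat) (f g : R -> R) :
  (forall x, D x -> E (g x)) -> Ck E n f -> Ck D n g ->
  Ck D n (fun x => f (g x)).
Proof.
intros HDE; revert f; induction n as [|n IH]; intros f Hf Hg; [exact I|].
pose proof (Ck_pred _ _ _ Hg) as Hg0.
destruct Hf as [f' [Hf Hf']], Hg as [g' [Hg Hg']].
exists (fun x => g' x * f' (g x)); split.
- intros x Dx; apply (is_derive_comp f g x (f' (g x)) (g' x)); auto.
- apply Ck_mult; auto.
Qed.

Lemma Ck_inv (D : R -> Prop) (n : nat) (f : R -> R) :
  (forall x, D x -> f x <> 0) -> Ck D n f -> Ck D n (fun x => / f x).
Proof.
intros Hnz; induction n as [|n IH]; intros Hf; [exact I|].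
pose proof (Ck_pred _ _ _ Hf) as Hf0.
destruct Hf as [f' [Hf Hf']].
(* The squared reciprocal is kept as a product of two factors [/ f x], to which the induction
   hypothesis applies. *)
exists (fun x => (-1 * f' x) * (/ f x * / f x)); split.
- intros x Dx.
  replace (-1 * f' x * (/ f x * / f x)) with (- f' x / f x ^ 2)
    by (field; auto).
  apply is_derive_inv; auto.
- apply Ck_mult; [apply Ck_mult; [apply Ck_const|exact Hf']|].
  apply Ck_mult; auto.
Qed.

Lemma Ck_ex_derive_n (D : R -> Prop) (n : nat) (f : R -> R) :
  open D -> Ck D n f -> forall x, D x -> ex_derive_n f n x.
Proof.
intros HD; revert f; induction n as [|n IH]; intros f Hf x Dx; [exact I|].
destruct Hf as [f' [Hf Hf']].
assert (Hloc : locally x (fun y => f' y = Derive f y)).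
{ apply (filter_imp D); [|now apply HD].
  intros y Dy; symmetry; apply is_derive_unique; auto. }
destruct n as [|n].
- exists (f' x); now apply Hf.
- pose proof (IH f' Hf' x Dx) as H; simpl in H |- *.
  apply (ex_derive_ext_loc (Derive_n f' n)); [|exact H].
  apply locally_locally in Hloc.
  revert Hloc; apply filter_imp; intros y Hy.
  rewrite (Derive_n_ext_loc _ _ n y Hy).
  (* [Ck] takes the first derivative and recurses on it, whereas [Derive_n] adds the last derivative
     outside; commuting the orders reconciles the two. *)
  change (Derive_n (Derive_n f 1) n y = Derive_n f (S n) y).
  rewrite Derive_n_comp; f_equal; lia.
Qed.

Lemma open_interval (a r : R) : open (fun x => Rabs (x - a) < r).
Proof.
intros x Hx.
assert (He : 0 < r - Rabs (x - a)) by lra.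
exists (mkposreal _ He); intros y Hy.
change (Rabs (y - x) < r - Rabs (x - a)) in Hy.
replace (y - a) with ((y - x) + (x - a)) by ring.
pose proof (Rabs_triang (y - x) (x - a)); lra.
Qed.

Lemma smooth_on_near (a r : R) (f : R -> R) :
  0 < r -> smooth_on (fun x => Rabs (x - a) < r) f -> smooth_near f a.
Proof.
intros Hr Hf; exists (mkposreal r Hr); intros x Hx n.
apply (Ck_ex_derive_n (fun y => Rabs (y - a) < r)); auto.
apply open_interval.
Qed.

Lemma derive_lower_bound (F F' : R -> R) (a b m : R) :
  (forall t, a < t < b -> is_derive F t (F' t)) ->
  (forall t, a < t < b -> m <= F' t) ->
  forall s t, a < s -> s <= t -> t < b -> m * (t - s) <= F t - F s.
Proof.
intros HF Hm s t Has Hst Htb.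
destruct (MVT_gen F s t F') as [z [Hz Ez]].
- intros z; rewrite Rmin_left, Rmax_right by lra; intros Hz; apply HF; lra.
- intros z; rewrite Rmin_left, Rmax_right by lra; intros Hz.
  apply continuity_pt_filterlim.
  apply (@ex_derive_continuous R_AbsRing R_NormedModule).
  exists (F' z); apply HF; lra.
- rewrite Rmin_left, Rmax_right in Hz by lra.
  rewrite Ez; apply Rmult_le_compat_r; [lra|apply Hm; lra].
Qed.

(* The inverse is taken on an interval where F' >= m; it is then (1/m)-Lipschitz,
   and G' = 1 / (F' o G) bootstraps its smoothness. *)
Lemma local_inverse (F : R -> R) (r d0 : R) :
  0 < r -> smooth_on (fun t => Rabs t < r) F -> is_derive F 0 d0 -> 0 < d0 ->
  exists (d eta L : R) (G : R -> R),
    0 < d < r /\ 0 < eta /\ 0 < L /\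
    (forall t, Rabs t < d -> G (F t) = t) /\
    (forall x, Rabs (x - F 0) < eta ->
       Rabs (G x) < d /\ F (G x) = x /\ Rabs (G x) <= L * Rabs (x - F 0)) /\
    smooth_on (fun x => Rabs (x - F 0) < eta) G.
Proof.
intros Hr HF Hd0 Hpos.
destruct (HF 2%nat) as [F' [HF1 [F'' [HF2 _]]]].
assert (E0 : F' 0 = d0).
{ rewrite <- (is_derive_unique _ _ _ Hd0); symmetry; apply is_derive_unique.
  apply HF1; rewrite Rabs_R0; exact Hr. }
set (m := d0 / 2).
assert (Hm : 0 < m) by (unfold m; lra).
assert (Hcont : continuous F' 0).
{ apply (@ex_derive_continuous R_AbsRing R_NormedModule).
  exists (F'' 0); apply HF2; rewrite Rabs_R0; exact Hr. }
assert (Hnear : locally 0 (fun t => m < F' t)).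
{ apply (Hcont (fun y => m < y)).
  rewrite E0; apply (open_gt m); unfold m; lra. }
destruct Hnear as [e He].
(* Halving keeps the closed interval of radius [d] inside the open one of radius [Rmin e r], on
   which [F'] is at least [m]. *)
set (d := Rmin e r / 2).
assert (Hd : 0 < d /\ d < e /\ d < r).
{ unfold d; pose proof (cond_pos e); pose proof (Rmin_l e r).
  pose proof (Rmin_r e r); assert (0 < Rmin e r) by (apply Rmin_pos; lra). lra. }
assert (Hder : forall t, Rabs t < r -> is_derive F t (F' t)) by exact HF1.
set (b := Rmin e r).
assert (Hdb : d < b) by (unfold d, b; unfold d in Hd; lra).
assert (Hb : forall t, - b < t < b -> Rabs t < r /\ m <= F' t).
{ intros t Ht; pose proof (Rmin_l e r); pose proof (Rmin_r e r); fold b in H, H0.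
  assert (Rabs t < b) by (apply Rabs_def1; lra).
  split; [lra|apply Rlt_le, He].
  change (Rabs (t - 0) < e); rewrite Rminus_0_r; lra. }
assert (Hlow : forall s t, - b < s -> s <= t -> t < b ->
          m * (t - s) <= F t - F s).
{ apply (derive_lower_bound F F' (- b) b m).
  - intros t Ht; apply Hder, Hb, Ht.
  - intros t Ht; apply Hb, Ht. }
assert (Hlip : forall s t, Rabs s <= d -> Rabs t <= d ->
          m * Rabs (t - s) <= Rabs (F t - F s)).
{ intros s t Hs Ht; apply Rabs_le_between in Hs; apply Rabs_le_between in Ht.
  destruct (Rle_dec s t) as [C|C].
  - pose proof (Hlow s t ltac:(lra) C ltac:(lra)).
    rewrite (Rabs_pos_eq (t - s)) by lra.
    apply (Rle_trans _ _ _ H), Rle_abs.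
  - pose proof (Hlow t s ltac:(lra) ltac:(lra) ltac:(lra)).
    rewrite (Rabs_minus_sym t s), (Rabs_minus_sym (F t)).
    rewrite (Rabs_pos_eq (s - t)) by lra.
    apply (Rle_trans _ _ _ H), Rle_abs. }
assert (Hinj : forall s t, Rabs s <= d -> Rabs t <= d -> F s = F t -> s = t).
{ intros s t Hs Ht E; pose proof (Hlip t s Ht Hs).
  assert (Es : F s - F t = 0) by lra.
  rewrite Es, Rabs_R0 in H.
  destruct (Req_dec s t) as [|N]; [assumption|exfalso].
  assert (0 < Rabs (s - t)) by (apply Rabs_pos_lt; lra).
  pose proof (Rmult_lt_0_compat _ _ Hm H0); lra. }
(* By the slope bound, [F d] and [F (- d)] lie on either side of [F 0] at distance at least [m * d],
   so the intermediate value theorem reaches every point within [eta]. *)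
set (eta := m * d).
assert (Heta : 0 < eta) by (apply Rmult_lt_0_compat; lra).
assert (Hsurj : forall x, Rabs (x - F 0) < eta ->
          exists t, Rabs t < d /\ F t = x).
{ intros x Hx; apply Rabs_def2 in Hx.
  pose proof (Hlow 0 d ltac:(lra) ltac:(lra) ltac:(lra)) as H1.
  pose proof (Hlow (- d) 0 ltac:(lra) ltac:(lra) ltac:(lra)) as H2.
  destruct (f_interv_is_interv F (- d) d x) as [t [Ht Et]].
  - lra.
  - unfold eta in Hx; lra.
  - intros t Ht; apply continuity_pt_filterlim.
    apply (@ex_derive_continuous R_AbsRing R_NormedModule).
    exists (F' t); apply Hder, Hb; lra.
  - exists t; split; [|exact Et].
    apply Rabs_def1.
    + destruct (Rle_lt_or_eq_dec t d ltac:(lra)) as [|E]; [assumption|].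
      subst t; unfold eta in Hx; lra.
    + destruct (Rle_lt_or_eq_dec (- d) t ltac:(lra)) as [|E]; [assumption|].
      subst t; unfold eta in Hx; lra. }
set (G := fun x => epsilon (inhabits 0) (fun t => Rabs t < d /\ F t = x)).
assert (HG : forall x, Rabs (x - F 0) < eta -> Rabs (G x) < d /\ F (G x) = x).
{ intros x Hx; apply (epsilon_spec (inhabits 0) _ (Hsurj x Hx)). }
assert (HGF : forall t, Rabs t < d -> G (F t) = t).
{ intros t Ht.
  assert (Ex : exists s, Rabs s < d /\ F s = F t) by (exists t; auto).
  pose proof (epsilon_spec (inhabits 0) _ Ex) as [H1 H2].
  apply Hinj; [|lra|exact H2]. now apply Rlt_le. }
assert (HGlip : forall x y, Rabs (x - F 0) < eta -> Rabs (y - F 0) < eta ->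
          m * Rabs (G y - G x) <= Rabs (y - x)).
{ intros x y Hx Hy; destruct (HG x Hx) as [Gx Ex], (HG y Hy) as [Gy Ey].
  rewrite <- Ex at 2; rewrite <- Ey at 2; apply Hlip; lra. }
assert (HGder : forall x, Rabs (x - F 0) < eta ->
          is_derive G x (/ F' (G x))).
{ intros x Hx; destruct (HG x Hx) as [Gx Ex].
  apply Rabs_def2 in Gx as Gx'.
  destruct (Hb (G x) ltac:(lra)) as [Gr Gm].
  assert (HD : derivable_pt_lim F (G x) (F' (G x)))
    by (apply is_derive_Reals, Hder, Gr).
  apply is_derive_Reals; intros eps Heps.
  (* The error [k / h - / F' (G x)] is, up to sign, [h / k - F' (G x)] divided by [h / k] and by
     [F' (G x)], both at least [m] in absolute value; hence the factor [m * m]. *)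
  destruct (HD (eps * m * m / 2)) as [dl Hdl].
  { unfold Rdiv; repeat apply Rmult_lt_0_compat; lra. }
  assert (Hq : 0 < Rmin (eta - Rabs (x - F 0)) (m * dl)).
  { apply Rmin_pos; [lra|apply Rmult_lt_0_compat; [lra|apply cond_pos]]. }
  exists (mkposreal _ Hq); simpl; intros h Hh0 Hh.
  pose proof (Rmin_l (eta - Rabs (x - F 0)) (m * dl)).
  pose proof (Rmin_r (eta - Rabs (x - F 0)) (m * dl)).
  assert (Hxh : Rabs (x + h - F 0) < eta).
  { replace (x + h - F 0) with ((x - F 0) + h) by ring.
    pose proof (Rabs_triang (x - F 0) h); lra. }
  destruct (HG (x + h) Hxh) as [Gh Eh].
  pose proof (HGlip x (x + h) Hx Hxh) as Hl.
  replace (x + h - x) with h in Hl by ring.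
  set (k := G (x + h) - G x) in *.
  assert (Ek : G (x + h) = G x + k) by (unfold k; ring).
  assert (Hk0 : k <> 0).
  { intros K; rewrite K, Rplus_0_r in Ek; rewrite Ek in Eh; lra. }
  assert (Hkd : Rabs k < dl).
  { apply (Rmult_lt_reg_l m); [exact Hm|lra]. }
  pose proof (Hdl k Hk0 Hkd) as Hlim.
  rewrite <- Ek, Eh, Ex in Hlim; replace (x + h - x) with h in Hlim by ring.
  assert (Hhk : m <= Rabs (h / k)).
  { unfold Rdiv; rewrite Rabs_mult, Rabs_inv.
    assert (0 < Rabs k) by now apply Rabs_pos_lt.
    apply (Rmult_le_reg_r (Rabs k)); [assumption|].
    rewrite Rmult_assoc, Rinv_l by lra; lra. }
  replace (k / h - / F' (G x))
    with (- (h / k - F' (G x)) * / (h / k) * / F' (G x)) by (field; lra).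
  rewrite !Rabs_mult, Rabs_Ropp, !Rabs_inv.
  rewrite (Rabs_pos_eq (F' (G x))) by lra.
  assert (B1 : 0 < / Rabs (h / k) <= / m).
  { split; [apply Rinv_0_lt_compat; lra|apply Rinv_le_contravar; lra]. }
  assert (B2 : 0 < / F' (G x) <= / m).
  { split; [apply Rinv_0_lt_compat; lra|apply Rinv_le_contravar; lra]. }
  apply Rle_lt_trans with (eps * m * m / 2 * / m * / m).
  - apply Rmult_le_compat; [apply Rmult_le_pos; [apply Rabs_pos|lra]|lra| |lra].
    apply Rmult_le_compat; [apply Rabs_pos|lra|lra|lra].
  - replace (eps * m * m / 2 * / m * / m) with (eps / 2) by (field; lra); lra. }
exists d, eta, (/ m), G; repeat split.
- lra.
- lra.
- exact Heta.
- now apply Rinv_0_lt_compat.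
- exact HGF.
- now apply HG.
- now apply HG.
- assert (H0 : Rabs (F 0 - F 0) < eta)
    by (rewrite Rminus_diag, Rabs_R0; exact Heta).
  pose proof (HGlip (F 0) x H0 H) as Hl.
  rewrite (HGF 0), Rminus_0_r in Hl by (rewrite Rabs_R0; lra).
  apply (Rmult_le_reg_l m); [exact Hm|].
  rewrite <- Rmult_assoc, Rinv_r, Rmult_1_l by lra; exact Hl.
- intros n; induction n as [|n IH]; [exact I|].
  exists (fun x => / F' (G x)); split; [exact HGder|].
  apply Ck_inv.
  + intros x Hx; destruct (HG x Hx) as [Gx _]; apply Rabs_def2 in Gx.
    destruct (Hb (G x) ltac:(lra)); lra.
  + apply (Ck_comp _ (fun t => Rabs t < d)); [|  |exact IH].
    * intros x Hx; apply HG, Hx.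
    (* Each order supplies its own witness [F1]; by uniqueness of derivatives it agrees with the
       fixed [F'] on the interval, so [F'] inherits its smoothness. *)
    * destruct (HF (S n)) as [F1 [HF1' HF1n]].
      apply (Ck_ext _ n F1).
      -- intros t Ht.
         destruct (open_interval 0 d t) as [e' He'];
           [now rewrite Rminus_0_r|].
         exists e'; intros y Hy; pose proof (He' y Hy) as K.
         now rewrite Rminus_0_r in K.
      -- intros t Ht; rewrite <- (is_derive_unique _ _ _ (HF1 t ltac:(lra))).
         symmetry; apply is_derive_unique, HF1'; lra.
      -- apply (Ck_subset (fun t => Rabs t < r)); [intros; lra|exact HF1n].
Qed.

(** * The invariant power series *)

(** Course-of-values recursion. [tab n] stores the first [n] values and 0 beyond; functional
    extensionality identifies it with the truncated sequence. *)
Lemma strong_recursion (F : nat -> (nat -> R) -> R) :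
  exists a : nat -> R, forall k,
    a k = F k (fun j => if (j <? k)%nat then a j else 0).
Proof.
pose (tab := fix tab (n : nat) : nat -> R :=
  match n with
  | O => fun _ => 0
  | S m => fun k => if (k =? m)%nat then F m (tab m) else tab m k
  end).
exists (fun k => tab (S k) k); intros k.
replace (tab (S k) k) with (F k (tab k)) by (simpl; now rewrite Nat.eqb_refl).
f_equal; apply functional_extensionality; intros j.
generalize k as n; intros n; induction n as [|n IH]; [reflexivity|].
change (tab (S n) j) with (if (j =? n)%nat then F n (tab n) else tab n j).
destruct (Nat.eqb_spec j n) as [->|N].
- replace (n <? S n)%nat with true by (symmetry; apply Nat.ltb_lt; lia).
  simpl; now rewrite Nat.eqb_refl.
- rewrite IH.
  destruct (Nat.ltb_spec j n), (Nat.ltb_spec j (S n)); try reflexivity; lia.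
Qed.

Lemma geometric_partial_sum (q : R) (n : nat) :
  0 < q < 1 -> sum_f_R0 (fun j => q ^ j) n <= / (1 - q).
Proof.
intros Hq; rewrite tech3 by lra; unfold Rdiv.
rewrite <- (Rmult_1_l (/ (1 - q))) at 2.
apply Rmult_le_compat_r; [left; apply Rinv_0_lt_compat; lra|].
pose proof (pow_lt q (S n) ltac:(lra)); lra.
Qed.

(** The order-k coefficient of the invariance equation, solved for a_k; [PS_mult] is the Cauchy
    product on its quadratic side. *)
Definition series_step (l1 l2 c beta : R) (k : nat) (f : nat -> R) : R :=
  - PS_mult (fun j => l1 ^ j * f j) (fun i => ((l1 ^ 2) ^ i - beta) * f i) k
  / (c * (l1 ^ k - l1) * (l1 ^ k - l2)).

(** At k = 1 the factor l1^k - l1 vanishes, so a_1 is free. For k >= 2, with M = |l1|, q = 1/M and e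
    = a_1, the denominator is at least c M^(2k) (1-q)^2, and if the earlier coefficients are bounded
    by e, the numerator is at most 2 e^2 M^(2k) / (1-q). The bound therefore propagates once e is
    small. *)
Lemma invariant_series (l1 l2 c beta : R) :
  l1 < -1 -> 0 < l2 < 1 -> 0 < c -> 0 <= beta < 1 ->
  exists a : nat -> R,
    a 0%nat = 0 /\ 0 < a 1%nat /\ (forall k, Rabs (a k) <= a 1%nat) /\
    (forall k, c * (l1 ^ k - l1) * (l1 ^ k - l2) * a k =
       - PS_mult (fun j => l1 ^ j * a j)
                 (fun i => ((l1 ^ 2) ^ i - beta) * a i) k).
Proof.
intros H1 H2 Hc Hb.
set (M := - l1); set (q := / M).
assert (HM : 1 < M) by (unfold M; lra).
assert (Hq : 0 < q < 1).
{ split; [apply Rinv_0_lt_compat; lra|].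
  unfold q; rewrite <- Rinv_1; apply Rinv_lt_contravar; lra. }
assert (HMq : M * q = 1) by (unfold q; field; lra).
(* Chosen so that 2 e^2 / (c (1-q)^3) is exactly e, which closes the induction. *)
set (e := c * (1 - q) ^ 3 / 2).
assert (He : 0 < e).
{ unfold e, Rdiv; repeat apply Rmult_lt_0_compat; lra. }
assert (HabsM : forall k, Rabs (l1 ^ k) = M ^ k).
{ intros k; rewrite <- RPow_abs, Rabs_left by lra; reflexivity. }
assert (HM1 : forall k, 1 <= M ^ k) by (intros k; apply pow_R1_Rle; lra).
destruct (strong_recursion (fun k f => match k with
  | O => 0 | S O => e | _ => series_step l1 l2 c beta k f end)) as [a Ha].
pose proof (Ha 0%nat) as A0; pose proof (Ha 1%nat) as A1; simpl in A0, A1.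
(* The full sequence may replace the truncated one: terms of the Cauchy product reaching index k
   carry the factor a_0 = 0. *)
assert (Hstep : forall k, (2 <= k)%nat -> a k = series_step l1 l2 c beta k a).
{ intros k Hk; rewrite (Ha k) at 1.
  destruct k as [|[|k]]; [lia|lia|].
  unfold series_step; f_equal; f_equal; unfold PS_mult; apply sum_eq.
  intros i Hi.
  destruct (Nat.ltb_spec i (S (S k))), (Nat.ltb_spec (S (S k) - i) (S (S k)));
    try reflexivity.
  - replace i with 0%nat by lia; rewrite A0; ring.
  - replace i with (S (S k)) by lia; rewrite Nat.sub_diag, A0; ring.
  - lia. }
(* M^k (1-q) equals M^k - M^(k-1), and for k >= 2 both |l1| = M and l2 are at most M^(k-1). *)
assert (Hden : forall k, (2 <= k)%nat ->
   M ^ k * (1 - q) <= Rabs (l1 ^ k - l1) /\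
   M ^ k * (1 - q) <= Rabs (l1 ^ k - l2)).
{ intros k Hk; destruct k as [|k]; [lia|].
  assert (E : M ^ S k * (1 - q) = M ^ S k - M ^ k).
  { simpl. replace (M * M ^ k * (1 - q)) with (M * M ^ k - (M * q) * M ^ k)
      by ring. rewrite HMq; ring. }
  rewrite E; split.
  - pose proof (Rabs_triang_inv (l1 ^ S k) l1).
    rewrite HabsM in H; rewrite (Rabs_left l1) in H by lra; fold M in H.
    assert (M <= M ^ k).
    { rewrite <- (pow_1 M) at 1; apply Rle_pow; [lra|lia]. }
    lra.
  - pose proof (Rabs_triang_inv (l1 ^ S k) l2).
    rewrite HabsM in H; rewrite (Rabs_pos_eq l2) in H by lra.
    pose proof (HM1 k); lra. }
assert (Hpos : forall k, 0 < M ^ k * (1 - q)).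
{ intros k; apply Rmult_lt_0_compat; [apply pow_lt|]; lra. }
exists a; rewrite A1; split; [exact A0|split; [exact He|split]].
- intros k; induction k as [k IH] using (well_founded_induction Nat.lt_wf_0).
  destruct k as [|[|k]].
  + rewrite A0, Rabs_R0; lra.
  + rewrite A1, Rabs_pos_eq; lra.
  + set (n := S (S k)) in *.
    assert (Hn : (2 <= n)%nat) by (unfold n; lia).
    destruct (Hden n Hn) as [D1 D2].
    rewrite (Hstep n Hn); unfold series_step, Rdiv.
    rewrite Rabs_mult, Rabs_Ropp, Rabs_inv, !Rabs_mult, (Rabs_pos_eq c) by lra.
    set (P := M ^ n * (1 - q)) in *; pose proof (Hpos n) as HP; fold P in HP.
    assert (Hnum : Rabs (PS_mult (fun j => l1 ^ j * a j)
              (fun i => ((l1 ^ 2) ^ i - beta) * a i) n)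
              <= 2 * e ^ 2 * M ^ n * M ^ n * / (1 - q)).
    { eapply Rle_trans; [apply Rsum_abs|].
      assert (HX : 0 <= 2 * e ^ 2 * M ^ n * M ^ n).
      { pose proof (pow_lt M n ltac:(lra)); pose proof (pow_lt e 2 He).
        apply Rmult_le_pos; [apply Rmult_le_pos|]; lra. }
      apply Rle_trans with
        (2 * e ^ 2 * M ^ n * M ^ n * sum_f_R0 (fun j => q ^ j) n);
        [|now apply Rmult_le_compat_l, geometric_partial_sum].
      rewrite scal_sum; apply sum_Rle; intros j Hj.
      (* The two end terms contain a_n, not yet bounded, but also a_0 = 0; all other indices fall
         under the induction hypothesis. *)
      destruct (Nat.eq_dec j 0) as [->|Nj0].
      { rewrite A0, Rmult_0_r, Rmult_0_l, Rabs_R0.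
        apply Rmult_le_pos; [apply pow_le; lra|exact HX]. }
      destruct (Nat.eq_dec j n) as [->|Njn].
      { rewrite Nat.sub_diag, A0, !Rmult_0_r, Rabs_R0.
        apply Rmult_le_pos; [apply pow_le; lra|exact HX]. }
      rewrite !Rabs_mult, HabsM.
      assert (Hq2 : Rabs ((l1 ^ 2) ^ (n - j) - beta)
                    <= 2 * (M ^ (n - j) * M ^ (n - j))).
      { rewrite <- pow_mult.
        pose proof (Rabs_triang (l1 ^ (2 * (n - j))) (- beta)) as Ht.
        rewrite HabsM, Rabs_Ropp, (Rabs_pos_eq beta) in Ht by lra.
        replace (2 * (n - j))%nat with ((n - j) + (n - j))%nat in * by lia.
        rewrite !pow_add in *.
        pose proof (HM1 (n - j)%nat).
        assert (1 * 1 <= M ^ (n - j) * M ^ (n - j))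
          by (apply Rmult_le_compat; lra).
        unfold Rminus; lra. }
      assert (Eq : q ^ j * (2 * e ^ 2 * M ^ n * M ^ n) =
         (M ^ j * e) * (2 * (M ^ (n - j) * M ^ (n - j)) * e)).
      { replace n with (j + (n - j))%nat at 1 2 by lia.
        rewrite !pow_add.
        replace (q ^ j * (2 * e ^ 2 * (M ^ j * M ^ (n - j)) *
                  (M ^ j * M ^ (n - j))))
          with ((M ^ j * q ^ j) * ((M ^ j * e) *
                  (2 * (M ^ (n - j) * M ^ (n - j)) * e))) by ring.
        rewrite <- Rpow_mult_distr, HMq, pow1; ring. }
      rewrite Eq.
      pose proof (pow_lt M j ltac:(lra)).
      apply Rmult_le_compat.
      - apply Rmult_le_pos; [lra|apply Rabs_pos].
      - apply Rmult_le_pos; apply Rabs_pos.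
      - apply Rmult_le_compat_l; [lra|apply IH; lia].
      - apply Rmult_le_compat; try apply Rabs_pos; [exact Hq2|apply IH; lia]. }
    assert (Hinv : / (c * Rabs (l1 ^ n - l1) * Rabs (l1 ^ n - l2))
                   <= / (c * P * P)).
    { apply Rinv_le_contravar.
      - apply Rmult_lt_0_compat; [apply Rmult_lt_0_compat|]; lra.
      - apply Rmult_le_compat; [apply Rmult_le_pos; lra|lra| |exact D2].
        apply Rmult_le_compat_l; lra. }
    eapply Rle_trans.
    { apply Rmult_le_compat; [apply Rabs_pos| |exact Hnum|exact Hinv].
      left; apply Rinv_0_lt_compat.
      apply Rmult_lt_0_compat; [apply Rmult_lt_0_compat|]; lra. }
    right; unfold P, e; field.
    pose proof (pow_lt M n ltac:(lra)); repeat split; lra.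
- intros k; destruct k as [|[|k]].
  + unfold PS_mult; simpl; rewrite A0; ring.
  + unfold PS_mult; simpl; rewrite A0; ring.
  + set (n := S (S k)).
    assert (Hn : (2 <= n)%nat) by (unfold n; lia).
    destruct (Hden n Hn) as [D1 D2]; pose proof (Hpos n).
    rewrite (Hstep n Hn) at 1; unfold series_step; field.
    repeat split.
    * intros E; rewrite E, Rabs_R0 in D2; lra.
    * intros E; rewrite E, Rabs_R0 in D1; lra.
    * lra.
Qed.

(** * Convergence and the functional equation *)

Lemma CV_radius_ge (a : nat -> R) (r K : R) :
  (forall n, Rabs (a n * r ^ n) <= K) -> Rbar_le r (CV_radius a).
Proof.
intros H; destruct (CV_radius_bounded a) as [U _]; apply U; exists K; exact H.
Qed.

Lemma PSeries_dilate (a : nat -> R) (l t : R) :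
  PSeries (fun n => l ^ n * a n) t = PSeries a (l * t).
Proof.
apply Series_ext; intros n; rewrite Rpow_mult_distr; ring.
Qed.

Lemma ex_pseries_dilate (a : nat -> R) (l t : R) :
  ex_pseries a (l * t) -> ex_pseries (fun n => l ^ n * a n) t.
Proof.
intros H; apply ex_pseries_R in H; apply ex_pseries_R.
assert (E : forall n, a n * (l * t) ^ n = l ^ n * a n * t ^ n)
  by (intros n; rewrite Rpow_mult_distr; ring).
exact (ex_series_ext _ _ E H).
Qed.

(* [h] parametrizes the unstable manifold: with [g = c + h], multiplication by
   [l1] in the parameter is the map [T] on the points [(g t, g (l1 t))]. *)
Lemma invariant_series_equation (l1 l2 c beta : R) (a : nat -> R) (t : R) :
  l1 < -1 -> 0 <= beta < 1 ->
  c * (l1 + l2) = -1 -> c * (l1 * l2) = - (beta * c + 1) ->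
  (forall k, Rabs (a k) <= a 1%nat) ->
  (forall k, c * (l1 ^ k - l1) * (l1 ^ k - l2) * a k =
       - PS_mult (fun j => l1 ^ j * a j)
                 (fun i => ((l1 ^ 2) ^ i - beta) * a i) k) ->
  Rabs (l1 ^ 2 * t) < 1 ->
  let h := PSeries a in
  h (l1 * t) * (h (l1 ^ 2 * t) - beta * h t) =
  (beta * c + 1) * h t - h (l1 * t) - c * h (l1 ^ 2 * t).
Proof.
intros H1 Hb Hs Hp Ha Hrec Ht h.
assert (Hm2 : 1 < l1 ^ 2) by (simpl; nra).
assert (Habs1 : Rabs l1 = - l1) by (apply Rabs_left; lra).
assert (Ht2 : l1 ^ 2 * Rabs t < 1).
{ rewrite Rabs_mult, (Rabs_pos_eq (l1 ^ 2)) in Ht by lra; exact Ht. }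
pose proof (Rabs_pos t) as Ht0.
assert (Htl : Rabs (l1 * t) < 1).
{ rewrite Rabs_mult, Habs1; simpl in Ht2; nra. }
assert (Ht1 : Rabs t < 1) by nra.
assert (CVa : Rbar_le 1 (CV_radius a)).
{ apply (CV_radius_ge a 1 (a 1%nat)); intros n; rewrite pow1, Rmult_1_r; apply Ha. }
assert (Hex : forall s, Rabs s < 1 -> ex_pseries a s).
{ intros s Hs1; apply CV_radius_inside.
  apply Rbar_lt_le_trans with 1; [exact Hs1|exact CVa]. }
pose proof (ex_pseries_dilate a (l1 ^ 2) t (Hex _ Ht)) as X2.
pose proof (ex_pseries_dilate a l1 t (Hex _ Htl)) as X1.
pose proof (Hex _ Ht1) as X0.
set (b1 := fun j => l1 ^ j * a j).
set (b2 := fun i => ((l1 ^ 2) ^ i - beta) * a i).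
assert (HA : 0 <= a 1%nat) by (apply Rle_trans with (2 := Ha 1%nat), Rabs_pos).
assert (Hr : Rabs t < / l1 ^ 2).
{ apply (Rmult_lt_reg_l (l1 ^ 2)); [lra|].
  rewrite Rinv_r by lra; exact Ht2. }
(* Both factors of the Cauchy product have radius of convergence at least 1 / l1^2, because [a] is
   bounded. *)
assert (C1 : Rbar_lt (Rabs t) (CV_radius b1)).
{ apply Rbar_lt_le_trans with (/ l1 ^ 2); [exact Hr|].
  apply (CV_radius_ge b1 _ (a 1%nat)); intros n; unfold b1.
  replace (l1 ^ n * a n * (/ l1 ^ 2) ^ n) with ((/ l1) ^ n * a n).
  - rewrite Rabs_mult, <- RPow_abs, Rabs_inv, Habs1.
    apply Rle_trans with (1 * a 1%nat); [|lra].
    apply Rmult_le_compat; [|apply Rabs_pos| |apply Ha].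
    + apply pow_le; left; apply Rinv_0_lt_compat; lra.
    + rewrite <- (pow1 n); apply pow_incr; split.
      * left; apply Rinv_0_lt_compat; lra.
      * rewrite <- Rinv_1; apply Rinv_le_contravar; lra.
  - replace (/ l1) with (l1 * / l1 ^ 2) by (field; lra).
    rewrite Rpow_mult_distr; ring. }
assert (C2 : Rbar_lt (Rabs t) (CV_radius b2)).
{ apply Rbar_lt_le_trans with (/ l1 ^ 2); [exact Hr|].
  apply (CV_radius_ge b2 _ (2 * a 1%nat)); intros n; unfold b2.
  replace (((l1 ^ 2) ^ n - beta) * a n * (/ l1 ^ 2) ^ n)
    with ((1 - beta * (/ l1 ^ 2) ^ n) * a n).
  - rewrite Rabs_mult; apply Rmult_le_compat; try apply Rabs_pos; [|apply Ha].
    assert (0 <= (/ l1 ^ 2) ^ n <= 1).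
    { assert (0 < / l1 ^ 2) by (apply Rinv_0_lt_compat; lra).
      split; [apply pow_le; lra|].
      rewrite <- (pow1 n); apply pow_incr; split; [lra|].
      rewrite <- Rinv_1; apply Rinv_le_contravar; lra. }
    apply Rabs_le; nra.
  - replace (((l1 ^ 2) ^ n - beta) * a n * (/ l1 ^ 2) ^ n)
      with (((l1 ^ 2) ^ n * (/ l1 ^ 2) ^ n - beta * (/ l1 ^ 2) ^ n) * a n) by ring.
    rewrite <- Rpow_mult_distr, Rinv_r, pow1 by lra; reflexivity. }
pose proof (PSeries_mult b1 b2 t C1 C2) as Emul.
assert (E1 : PSeries b1 t = h (l1 * t)) by apply PSeries_dilate.
assert (E2 : PSeries b2 t = h (l1 ^ 2 * t) - beta * h t).
{ unfold h; rewrite <- PSeries_dilate; unfold PSeries.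
  rewrite <- Series_scal_l, <- Series_minus.
  - apply Series_ext; intros n; unfold b2; ring.
  - now apply ex_pseries_R.
  - now apply (ex_series_scal (V := R_NormedModule) beta (fun n => a n * t ^ n)),
    ex_pseries_R. }
rewrite E1, E2 in Emul; rewrite <- Emul.
unfold h; rewrite <- !PSeries_dilate; unfold PSeries.
rewrite <- !Series_scal_l, <- Series_minus, <- Series_minus.
- apply Series_ext; intros n.
  (* The recurrence gives the product coefficient; expanding c (X - l1) (X - l2) = c X^2 + X - (beta
     c + 1) at X = l1^n produces the linear side. *)
  replace (PS_mult b1 b2 n) with (- (c * (l1 ^ n - l1) * (l1 ^ n - l2) * a n))
    by (rewrite Hrec; unfold b1, b2; ring).
  rewrite <- pow_mult, Nat.mul_comm, pow_mult.
  replace (- (c * (l1 ^ n - l1) * (l1 ^ n - l2) * a n)) with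
    (- (c * (l1 ^ n) ^ 2 - (c * (l1 + l2)) * l1 ^ n + c * (l1 * l2)) * a n) by ring.
  rewrite Hs, Hp; ring.
- apply (ex_series_minus (V := R_NormedModule)).
  + now apply (ex_series_scal (V := R_NormedModule) (beta * c + 1) (fun n => a n * t ^ n)),
    ex_pseries_R.
  + apply ex_pseries_R, X1.
- now apply (ex_series_scal (V := R_NormedModule) c (fun n => (l1 ^ 2) ^ n * a n * t ^ n)),
    ex_pseries_R.
- now apply (ex_series_scal (V := R_NormedModule) (beta * c + 1) (fun n => a n * t ^ n)),
    ex_pseries_R.
- apply ex_pseries_R, X1.
Qed.

(** * Contact of order four *)

(** [l1] and [l2] are the roots of c X^2 + X - (beta c + 1), which is c times the characteristic
    polynomial of the linearization. The bounds l1 < -1 and l2 < 1 amount to 2 c - 1 < theta < 2 c +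
    1, obtained by comparing squares. *)
Lemma eigenvalue_facts (alpha beta : R) :
  0 < alpha < 1 -> 0 <= beta < 1 ->
  let c := xbar alpha beta in
  let l1 := lambda1 alpha beta in
  let l2 := lambda2 alpha beta in
  0 < c /\ alpha + beta * c + 1 = c /\ l1 < -1 /\ 0 < l2 < 1 /\
  c * (l1 + l2) = -1 /\ c * (l1 * l2) = - (beta * c + 1) /\
  theta alpha beta = c * (l2 - l1).
Proof.
intros Ha Hb c l1 l2.
assert (Hcb : c * (1 - beta) = 1 + alpha)
  by (unfold c, xbar; field; lra).
assert (Hc : 0 < c) by (unfold c, xbar; apply Rdiv_lt_0_compat; lra).
set (th := theta alpha beta).
assert (Hrad : 0 <= 1 + 4 * c + 4 * beta * c ^ 2) by (simpl; nra).
assert (Hth0 : 0 <= th) by apply sqrt_pos.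
assert (Hth : th * th = 1 + 4 * c + 4 * beta * c ^ 2)
  by (apply sqrt_sqrt, Hrad).
assert (E1 : l1 = (- 1 - th) / (2 * c)) by reflexivity.
assert (E2 : l2 = (- 1 + th) / (2 * c)) by reflexivity.
assert (B0 : 1 < th) by (simpl in Hth; nra).
(* Otherwise squaring gives c (1 - beta) >= 2, against c (1 - beta) = 1 + alpha < 2. *)
assert (B1 : 2 * c - 1 < th).
{ destruct (Rlt_dec (2 * c - 1) th) as [|N]; [assumption|exfalso].
  assert (th * th <= (2 * c - 1) * (2 * c - 1))
    by (apply Rmult_le_compat; lra).
  assert (c * (c * (1 - beta)) < c * 2) by (apply Rmult_lt_compat_l; lra).
  rewrite Hth in *; lra. }
assert (B2 : th < 2 * c + 1).
{ destruct (Rlt_dec th (2 * c + 1)) as [|N]; [assumption|exfalso].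
  assert ((2 * c + 1) * (2 * c + 1) <= th * th)
    by (apply Rmult_le_compat; lra).
  assert (0 < c * c * (1 - beta))
    by (apply Rmult_lt_0_compat; [apply Rmult_lt_0_compat|]; lra).
  rewrite Hth in *; lra. }
repeat split.
- exact Hc.
- lra.
- rewrite E1; apply (Rmult_lt_reg_r (2 * c)); [lra|].
  unfold Rdiv; rewrite Rmult_assoc, Rinv_l by lra; lra.
- rewrite E2; apply Rdiv_lt_0_compat; lra.
- rewrite E2; apply (Rmult_lt_reg_r (2 * c)); [lra|].
  unfold Rdiv; rewrite Rmult_assoc, Rinv_l by lra; lra.
- rewrite E1, E2; field; lra.
- rewrite E1, E2.
  replace (c * ((-1 - th) / (2 * c) * ((-1 + th) / (2 * c))))
    with ((1 - th * th) / (4 * c)) by (field; lra).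
  rewrite Hth; field; lra.
- fold th; rewrite E1, E2; field; lra.
Qed.

(** The eigenvectors are (1, l1) and (1, l2). With these values gamma1 u - gamma2 v vanishes on the
    first and gamma1 u + gamma3 v on the second, so the linear forms in [U] are eigencoordinates. *)
Lemma gamma_eq (alpha beta : R) :
  0 < alpha < 1 -> 0 <= beta < 1 ->
  let l1 := lambda1 alpha beta in
  let l2 := lambda2 alpha beta in
  gamma1 alpha beta = l1 * l2 / (l2 - l1) /\
  gamma2 alpha beta = l2 / (l2 - l1) /\
  gamma3 alpha beta = - l1 / (l2 - l1).
Proof.
intros Ha Hb l1 l2.
destruct (eigenvalue_facts alpha beta Ha Hb)
  as (Hc & _ & H1 & H2 & Hs & Hp & Hth); fold l1 l2 in H1, H2, Hs, Hp, Hth.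
unfold gamma1, gamma2, gamma3; rewrite Hth; fold l1 l2.
set (c := xbar alpha beta) in *.
repeat split.
- replace (1 + beta * c) with (- (c * (l1 * l2))) by lra; field; lra.
- replace (c * (l2 - l1) - 1) with (c * (l2 - l1) + c * (l1 + l2)) by lra.
  field; lra.
- replace (c * (l2 - l1) + 1) with (c * (l2 - l1) - c * (l1 + l2)) by lra.
  field; lra.
Qed.

(** The hypotheses are the series recurrence at k = 2 and k = 3; the conclusions say that the
    coefficients of t, t^2 and t^3 of [U] along the parametrized curve vanish. *)
Lemma contact_coefficients (alpha beta b1 b2 b3 : R) :
  0 < alpha < 1 -> 0 <= beta < 1 ->
  let c := xbar alpha beta in
  let l1 := lambda1 alpha beta in
  let l2 := lambda2 alpha beta in
  let g1 := gamma1 alpha beta in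
  let g2 := gamma2 alpha beta in
  let g3 := gamma3 alpha beta in
  c * (l1 ^ 2 - l1) * (l1 ^ 2 - l2) * b2 = - (l1 * (l1 ^ 2 - beta) * b1 ^ 2) ->
  c * (l1 ^ 3 - l1) * (l1 ^ 3 - l2) * b3 =
    - (l1 * (l1 ^ 4 - beta) + l1 ^ 2 * (l1 ^ 2 - beta)) * (b1 * b2) ->
  (g1 - g2 * l1) * b1 = 0 /\
  (g1 - g2 * l1 ^ 2) * b2 + a2 alpha beta * ((g1 + g3 * l1) * b1) ^ 2 = 0 /\
  (g1 - g2 * l1 ^ 3) * b3
  + 2 * a2 alpha beta * ((g1 + g3 * l1) * b1) * ((g1 + g3 * l1 ^ 2) * b2)
  + a3 alpha beta * ((g1 + g3 * l1) * b1) ^ 3 = 0.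
Proof.
intros Ha Hb c l1 l2 g1 g2 g3 Hb2 Hb3.
destruct (eigenvalue_facts alpha beta Ha Hb)
  as (Hc & _ & H1 & H2 & Hs & Hp & Hth).
destruct (gamma_eq alpha beta Ha Hb) as (G1 & G2 & G3).
fold c in Hc, Hs, Hp, Hth; fold l1 l2 in H1, H2, Hs, Hp, Hth, G1, G2, G3.
fold g1 in G1; fold g2 in G2; fold g3 in G3.
assert (Hneg : l1 + l2 < 0) by nra.
assert (Ec : c = - / (l1 + l2)).
{ apply (Rmult_eq_reg_r (l1 + l2)); [rewrite Hs; field|]; lra. }
assert (Eb : beta = l1 + l2 - l1 * l2).
{ apply (Rmult_eq_reg_l c); lra. }
assert (N1 : l1 ^ 2 - l2 <> 0) by (simpl; nra).
assert (N2 : l1 ^ 3 - l2 <> 0) by (assert (l1 ^ 3 < 0) by (simpl; nra); lra).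
assert (N3 : l1 ^ 2 - l1 <> 0) by (simpl; nra).
assert (N4 : l1 ^ 3 - l1 <> 0) by (simpl; nra).
assert (Eb2 : b2 = - (l1 * (l1 ^ 2 - beta) * b1 ^ 2)
                  / (c * (l1 ^ 2 - l1) * (l1 ^ 2 - l2))).
{ rewrite <- Hb2; field; repeat split; lra. }
assert (Eb3 : b3 = - (l1 * (l1 ^ 4 - beta) + l1 ^ 2 * (l1 ^ 2 - beta)) * (b1 * b2)
                  / (c * (l1 ^ 3 - l1) * (l1 ^ 3 - l2))).
{ rewrite <- Hb3; field; repeat split; lra. }
(* Each 1 is rewritten as -c (l1 + l2) and theta as c (l2 - l1); once [c] and [beta] are also
   eliminated, the goals are rational identities in [l1], [l2] and [b1]. *)
assert (EA2 : a2 alpha beta =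
  (c * (l2 - l1) - c * (l1 + l2) + 2 * beta * c) /
  (c * (l2 - l1) * (c * (l2 - l1) - c * (l1 + l2)) * (l1 ^ 2 - l2) * c)).
{ unfold a2; rewrite Hth, Hs; fold l1 l2 c; f_equal; [lra|f_equal; lra]. }
assert (EA3 : a3 alpha beta =
  a2 alpha beta / ((l1 ^ 3 - l2) * c) *
  (l2 - l1 ^ 2 - (1 + 2 * beta * c) / (c * (l2 - l1) * c) * (1 / l1 + l1 / l2)
   - l1 / (l2 * c))).
{ unfold a3; rewrite Hth; reflexivity. }
rewrite EA3, EA2, Eb3, Eb2, G1, G2, G3.
clearbody l1 l2 c g1 g2 g3; clear - H1 H2 Hneg Ec Eb N1 N2 N3 N4.
subst c beta.
repeat split; field; repeat split; try lra.
Qed.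

Lemma PSeries_smooth_on (a : nat -> R) (r : R) :
  Rbar_le r (CV_radius a) -> smooth_on (fun t => Rabs t < r) (PSeries a).
Proof.
intros Hr n; revert a Hr; induction n as [|n IH]; intros a Hr; [exact I|].
exists (PSeries (PS_derive a)); split.
- intros t Ht; apply is_derive_PSeries.
  apply Rbar_lt_le_trans with r; [exact Ht|exact Hr].
- apply IH; rewrite CV_radius_derive; exact Hr.
Qed.

Lemma ex_derive_continuous_R (f : R -> R) (x : R) :
  ex_derive f x -> continuous f x.
Proof. apply (@ex_derive_continuous R_AbsRing R_NormedModule). Qed.

Lemma smooth_on_ex_derive (D : R -> Prop) (f : R -> R) (x : R) :
  smooth_on D f -> D x -> ex_derive f x.
Proof.
intros Hf Dx; destruct (Hf 1%nat) as [f' [Hf' _]]; exists (f' x); auto.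
Qed.

Lemma continuous_near (f : R -> R) (x eps : R) :
  continuous f x -> 0 < eps ->
  exists d, 0 < d /\ forall y, Rabs (y - x) < d -> Rabs (f y - f x) < eps.
Proof.
intros Hf He.
destruct (proj1 (filterlim_locally f (f x)) Hf (mkposreal eps He)) as [d Hd].
exists d; split; [apply cond_pos|exact Hd].
Qed.

Lemma ex_derive_locally_bounded (f : R -> R) (x : R) :
  ex_derive f x ->
  exists K d, 0 < d /\ forall y, Rabs (y - x) < d -> Rabs (f y) <= K.
Proof.
intros Hf; apply ex_derive_continuous_R in Hf.
destruct (continuous_near f x 1 Hf Rlt_0_1) as [d [Hd Hb]].
exists (Rabs (f x) + 1), d; split; [exact Hd|]; intros y Hy.
pose proof (Hb y Hy); pose proof (Rabs_triang (f y - f x) (f x)).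
replace (f y - f x + f x) with (f y) in H0 by ring; lra.
Qed.

(** Along the curve the polynomial [U] equals its terms of degree 1 to 3, which vanish, plus t^4
    Q(t) with Q continuous at 0, hence bounded nearby. *)
Lemma curve_contact (alpha beta : R) (a : nat -> R) :
  0 < alpha < 1 -> 0 <= beta < 1 ->
  let c := xbar alpha beta in
  let l1 := lambda1 alpha beta in
  let l2 := lambda2 alpha beta in
  a 0%nat = 0 -> (forall k, Rabs (a k) <= a 1%nat) ->
  (forall k, c * (l1 ^ k - l1) * (l1 ^ k - l2) * a k =
       - PS_mult (fun j => l1 ^ j * a j)
                 (fun i => ((l1 ^ 2) ^ i - beta) * a i) k) ->
  exists K d, 0 < d /\ forall t, Rabs t < d ->
    Rabs (U alpha beta (c + PSeries a t) (c + PSeries a (l1 * t)))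
    <= K * Rabs t ^ 4.
Proof.
intros Ha Hb c l1 l2 A0 Abd Hrec.
destruct (eigenvalue_facts alpha beta Ha Hb)
  as (Hc & _ & H1 & H2 & Hs & Hp & Hth).
fold c in Hc, Hs, Hp; fold l1 in H1, Hs, Hp; fold l2 in H2, Hs, Hp.
set (b1 := a 1%nat); set (b2 := a 2%nat); set (b3 := a 3%nat).
destruct (contact_coefficients alpha beta b1 b2 b3 Ha Hb) as (R1 & R2 & R3).
{ fold c l1 l2; unfold b2; rewrite (Hrec 2%nat).
  unfold PS_mult; simpl; rewrite A0; fold b1; ring. }
{ fold c l1 l2; unfold b3; rewrite (Hrec 3%nat).
  unfold PS_mult; simpl; rewrite A0; fold b1 b2; ring. }
fold l1 in R1, R2, R3.
set (r := PSeries (PS_decr_n a 4)).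
assert (Hex : forall s, Rabs s < 1 -> ex_pseries a s).
{ intros s Hs1; apply CV_radius_inside.
  apply Rbar_lt_le_trans with 1; [exact Hs1|].
  apply (CV_radius_ge a 1 (a 1%nat)); intros n.
  rewrite pow1, Rmult_1_r; apply Abd. }
assert (Hh : forall s, Rabs s < 1 ->
  PSeries a s = b1 * s + b2 * s ^ 2 + b3 * s ^ 3 + s ^ 4 * r s).
{ intros s Hs1; rewrite (PSeries_decr_n a 3 s (Hex s Hs1)); fold r.
  simpl sum_f_R0; rewrite A0; fold b1 b2 b3; ring. }
assert (Hr : ex_derive r 0).
{ apply (smooth_on_ex_derive (fun t => Rabs t < 1));
    [|rewrite Rabs_R0; lra].
  apply PSeries_smooth_on, (CV_radius_ge _ 1 (a 1%nat)); intros n.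
  rewrite pow1, Rmult_1_r; apply Abd. }
assert (Hr1 : ex_derive r (l1 * 0)) by now rewrite Rmult_0_r.
set (g1 := gamma1 alpha beta) in *; set (g2 := gamma2 alpha beta) in *.
set (g3 := gamma3 alpha beta) in *.
set (A := a2 alpha beta) in *; set (B := a3 alpha beta) in *.
set (w1 := (g1 + g3 * l1) * b1) in *.
set (w2 := (g1 + g3 * l1 ^ 2) * b2) in *.
set (w3 := (g1 + g3 * l1 ^ 3) * b3) in *.
(* On the curve the form gamma1 (x - c) + gamma3 (y - c) equals w1 t + t^2 z(t), where z = w2 + t s.
   Expanding its square and cube and collecting the multiples of t^4 gives [Q]. *)
set (s := fun t => w3 + t * (g1 * r t + g3 * l1 ^ 4 * r (l1 * t))).
set (z := fun t => w2 + t * (w3 + t * (g1 * r t + g3 * l1 ^ 4 * r (l1 * t)))).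
set (Q := fun t => g1 * r t - g2 * l1 ^ 4 * r (l1 * t)
  + A * (z t ^ 2 + 2 * w1 * s t)
  + B * (3 * w1 ^ 2 * z t + 3 * w1 * z t ^ 2 * t + z t ^ 3 * t ^ 2)).
destruct (ex_derive_locally_bounded Q 0) as [K [d [Hd HK]]].
{ unfold Q, z, s; auto_derive; repeat split; assumption. }
assert (Hm : 0 < / - l1) by (apply Rinv_0_lt_compat; lra).
assert (Hm1 : / - l1 < 1).
{ rewrite <- Rinv_1; apply Rinv_lt_contravar; lra. }
exists K, (Rmin d (/ - l1)); split; [apply Rmin_pos; lra|].
intros t Ht.
pose proof (Rmin_l d (/ - l1)); pose proof (Rmin_r d (/ - l1)).
assert (Ht1 : Rabs (l1 * t) < 1).
{ rewrite Rabs_mult, (Rabs_left l1) by lra.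
  apply (Rmult_lt_reg_l (/ - l1)); [exact Hm|].
  rewrite <- Rmult_assoc, Rinv_l by lra; lra. }
replace (U alpha beta (c + PSeries a t) (c + PSeries a (l1 * t)))
  with (t ^ 4 * Q t).
- rewrite Rabs_mult, <- RPow_abs, Rmult_comm.
  apply Rmult_le_compat_r; [apply pow_le, Rabs_pos|].
  apply HK; rewrite Rminus_0_r; lra.
- unfold U; fold c g1 g2 g3 A B.
  rewrite (Hh t) by lra; rewrite (Hh _ Ht1).
  transitivity (t ^ 4 * Q t + ((g1 - g2 * l1) * b1) * t
    + ((g1 - g2 * l1 ^ 2) * b2 + A * w1 ^ 2) * t ^ 2
    + ((g1 - g2 * l1 ^ 3) * b3 + 2 * A * w1 * w2 + B * w1 ^ 3) * t ^ 3).
  + rewrite R1, R2, R3; ring.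
  + unfold Q, z, s, w1, w2, w3; ring.
Qed.

(** The functional equation is the second component of [T] at [(g t, g (l1 * t))], cleared of the
    denominator [g (l1 * t)]. *)
Lemma unstable_parametrization (alpha beta : R) :
  0 < alpha < 1 -> 0 <= beta < 1 ->
  let c := xbar alpha beta in
  let l1 := lambda1 alpha beta in
  exists (g : R -> R) (e : R),
    smooth_on (fun t => Rabs t < 1) g /\ g 0 = c /\
    is_derive g 0 e /\ 0 < e /\
    (forall t, Rabs (l1 ^ 2 * t) < 1 ->
       g (l1 ^ 2 * t) * g (l1 * t) = (alpha + beta * g t) * g (l1 * t) + g t) /\
    (exists K d, 0 < d /\ forall t, Rabs t < d ->
       Rabs (U alpha beta (g t) (g (l1 * t))) <= K * Rabs t ^ 4).
Proof.
intros Ha Hb c l1.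
destruct (eigenvalue_facts alpha beta Ha Hb)
  as (Hc & Hfix & H1 & H2 & Hs & Hp & _).
fold c in Hc, Hs, Hp, Hfix; fold l1 in H1, Hs, Hp.
destruct (invariant_series l1 (lambda2 alpha beta) c beta H1 H2 Hc Hb)
  as [a (A0 & A1 & Abd & Arec)].
assert (CVa : Rbar_le 1 (CV_radius a)).
{ apply (CV_radius_ge a 1 (a 1%nat)); intros n.
  rewrite pow1, Rmult_1_r; apply Abd. }
exists (fun t => c + PSeries a t), (a 1%nat).
split; [|split; [|split; [|split; [exact A1|split]]]].
- intros n; apply Ck_plus; [apply Ck_const|now apply PSeries_smooth_on].
- rewrite PSeries_0, A0; ring.
- replace (a 1%nat) with (0 + PSeries (PS_derive a) 0)
    by (rewrite PSeries_0; unfold PS_derive; simpl; ring).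
  apply (is_derive_plus (fun _ => c) (PSeries a) 0 0 (PSeries (PS_derive a) 0)).
  + exact (is_derive_const c 0).
  + apply is_derive_PSeries; rewrite Rabs_R0.
    apply Rbar_lt_le_trans with 1; [simpl; lra|exact CVa].
- intros t Ht.
  pose proof (invariant_series_equation l1 _ c beta a t H1 Hb Hs Hp Abd Arec Ht)
    as E; simpl in E.
  replace (l1 ^ 2) with (l1 * (l1 * 1)) by reflexivity.
  set (h0 := PSeries a t) in *; set (h1 := PSeries a (l1 * t)) in *.
  set (h2 := PSeries a (l1 * (l1 * 1) * t)) in *.
  (* The fixed point relation makes the constant terms cancel. *)
  replace alpha with (c - beta * c - 1) by lra.
  replace ((c + h2) * (c + h1))
    with (c * c + c * h1 + c * h2 + beta * h0 * h1 + h1 * (h2 - beta * h0))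
    by ring.
  rewrite E; ring.
- exact (curve_contact alpha beta a Ha Hb A0 Abd Arec).
Qed.

(** * The cubic curve as a graph *)

(** With w = gamma1 (x - c) + gamma3 (y - c) and S(w) = A w^2 + B w^3, the curve is gamma1 (x - c) -
    gamma2 (y - c) = - S(w). Since gamma2 + gamma3 = 1, these two linear equations give x and y as
    polynomials in w, and x(w) is locally invertible. *)
Lemma implicit_solution (alpha beta : R) :
  0 < alpha < 1 -> 0 <= beta < 1 ->
  exists phi : R -> R, U_solution alpha beta phi /\
    forall psi : R -> R, U_solution alpha beta psi ->
      locally (xbar alpha beta) (fun x => psi x = phi x).
Proof.
intros Ha Hb.
destruct (eigenvalue_facts alpha beta Ha Hb)
  as (Hc & _ & H1 & H2 & Hs & Hp & _).
destruct (gamma_eq alpha beta Ha Hb) as (G1 & G2 & G3).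
set (c := xbar alpha beta) in *; set (l1 := lambda1 alpha beta) in *.
set (l2 := lambda2 alpha beta) in *.
unfold U_solution, U.
set (g1 := gamma1 alpha beta) in *; set (g2 := gamma2 alpha beta) in *.
set (g3 := gamma3 alpha beta) in *.
set (A := a2 alpha beta) in *; set (B := a3 alpha beta) in *.
fold c.
assert (Hl : 0 < l2 - l1) by lra.
assert (Eg : g1 = g2 * l1) by (rewrite G1, G2; field; lra).
assert (Es : g2 + g3 = 1) by (rewrite G2, G3; field; lra).
assert (Pg2 : 0 < g2) by (rewrite G2; apply Rdiv_lt_0_compat; lra).
assert (Ng1 : g1 <> 0) by (rewrite Eg; nra).
clearbody c l1 l2 g1 g2 g3 A B.
set (S := fun w => A * (w * w) + B * (w * (w * w))).
(* The parameter is s = w / l1, a scaling that makes X'(0) = gamma2 l1 / gamma1 equal to 1. *)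
set (X := fun s => c + / g1 * (g2 * (l1 * s) + - g3 * S (l1 * s))).
set (Y := fun s => c + (l1 * s + S (l1 * s))).
assert (SS : forall D, smooth_on D (fun s => S (l1 * s))).
{ intros D n; unfold S.
  repeat first [apply Ck_plus | apply Ck_mult | apply Ck_const | apply Ck_id]. }
assert (SX : forall D, smooth_on D X).
{ intros D n; unfold X.
  repeat first [apply SS | apply Ck_const | apply Ck_id | apply Ck_plus
    | apply Ck_mult]. }
assert (SY : forall D, smooth_on D Y).
{ intros D n; unfold Y.
  repeat first [apply SS | apply Ck_const | apply Ck_id | apply Ck_plus
    | apply Ck_mult]. }
assert (DX : is_derive X 0 1).
{ unfold X, S; auto_derive; [exact I|]. rewrite Eg; field; split; lra. }
assert (X0 : X 0 = c) by (unfold X, S; ring).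
destruct (local_inverse X 1 1 Rlt_0_1 (SX _) DX Rlt_0_1)
  as (d & eta & L & G & Hd & Heta & HL & HGX & HXG & SG).
rewrite X0 in HXG, SG.
exists (fun x => Y (G x)); repeat split.
- apply (smooth_on_near c eta); [exact Heta|]; intros n.
  apply (Ck_comp _ (fun _ => True)); [auto|apply SY|apply SG].
- rewrite <- X0 at 1; rewrite HGX by (rewrite Rabs_R0; lra).
  unfold Y, S; ring.
- exists (mkposreal eta Heta); intros x Hx.
  destruct (HXG x Hx) as (_ & E & _).
  rewrite <- E at 1 3 5.
  set (s := G x).
  assert (E1 : g1 * (X s - c) = g2 * (l1 * s) - g3 * S (l1 * s))
    by (unfold X; field; exact Ng1).
  rewrite E1; unfold Y.
  replace g3 with (1 - g2) by lra; unfold S; ring.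
- intros psi (Spsi & psi0 & HU).
  assert (Cpsi : continuous (fun x => / l1 * (g1 * (x - c) + g3 * (psi x - c))) c).
  { apply ex_derive_continuous_R.
    assert (Dpsi : ex_derive psi c) by exact (locally_singleton _ _ Spsi 1%nat).
    auto_derive; auto. }
  destruct (continuous_near _ c d Cpsi) as [e [He Hnear]]; [lra|].
  rewrite psi0 in Hnear.
  replace (/ l1 * (g1 * (c - c) + g3 * (c - c))) with 0 in Hnear by ring.
  destruct HU as [e' HU].
  assert (Hm : 0 < Rmin e e') by (apply Rmin_pos; [lra|apply cond_pos]).
  exists (mkposreal _ Hm); intros x Hx.
  change (Rabs (x - c) < Rmin e e') in Hx.
  pose proof (Rmin_l e e'); pose proof (Rmin_r e e').
  specialize (HU x ltac:(change (Rabs (x - c) < e'); lra)).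
  specialize (Hnear x ltac:(lra)); rewrite Rminus_0_r in Hnear.
  (* Uniqueness: the parameter of the point [(x, psi x)] is small by continuity and satisfies
     [X s = x], so it equals [G x]. *)
  set (s := / l1 * (g1 * (x - c) + g3 * (psi x - c))) in *.
  assert (Ew : g1 * (x - c) + g3 * (psi x - c) = l1 * s)
    by (unfold s; field; lra).
  rewrite Ew in HU.
  assert (ES : S (l1 * s) = g2 * (psi x - c) - g1 * (x - c)).
  { unfold S; simpl in HU; lra. }
  assert (EX : X s = x).
  { unfold X; rewrite ES, <- Ew.
    replace (g2 * (g1 * (x - c) + g3 * (psi x - c))
             + - g3 * (g2 * (psi x - c) - g1 * (x - c)))
      with ((g2 + g3) * g1 * (x - c)) by ring.
    rewrite Es; field; exact Ng1. }
  rewrite <- EX at 2; rewrite HGX by exact Hnear.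
  unfold Y; rewrite ES, <- Ew.
  replace (c + _) with (c + (g2 + g3) * (psi x - c)) by ring.
  rewrite Es; ring.
Qed.

(** * The local unstable manifold *)

(** Iteration gives |u_0| <= k^n |u_n| <= k^n K for every n. *)
Lemma backward_contraction_zero (u : nat -> R) (k K : R) :
  0 <= k < 1 -> (forall n, Rabs (u n) <= k * Rabs (u (S n))) ->
  (forall n, Rabs (u n) <= K) -> u 0%nat = 0.
Proof.
intros Hk Hu HK.
assert (HK0 : 0 <= K) by (apply Rle_trans with (2 := HK 0%nat), Rabs_pos).
assert (Hn : forall n, Rabs (u 0%nat) <= k ^ n * K).
{ intros n; apply Rle_trans with (k ^ n * Rabs (u n)).
  - induction n as [|n IH]; [simpl; lra|].
    apply (Rle_trans _ _ _ IH); simpl (k ^ S n).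
    rewrite (Rmult_comm k), Rmult_assoc.
    apply Rmult_le_compat_l; [apply pow_le; lra|apply Hu].
  - apply Rmult_le_compat_l; [apply pow_le; lra|apply HK]. }
destruct (Req_dec (u 0%nat) 0) as [|N]; [assumption|exfalso].
assert (P : 0 < Rabs (u 0%nat)) by now apply Rabs_pos_lt.
destruct (pow_lt_1_zero k ltac:(rewrite Rabs_pos_eq; lra)
  (Rabs (u 0%nat) / (K + 1))) as [n0 Hn0].
{ apply Rdiv_lt_0_compat; lra. }
specialize (Hn0 n0 (le_n n0)); specialize (Hn n0).
rewrite Rabs_pos_eq in Hn0 by (apply pow_le; lra).
assert (k ^ n0 * (K + 1) < Rabs (u 0%nat)).
{ apply (Rmult_lt_reg_r (/ (K + 1))); [apply Rinv_0_lt_compat; lra|].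
  rewrite Rmult_assoc, Rinv_r, Rmult_1_r by lra; exact Hn0. }
pose proof (pow_le k n0 ltac:(lra)); lra.
Qed.

(** Up to sign, y / (z z') is the difference quotient of y / z in z. It is monotone in each
    variable, so on the box it lies between [f (- s)] and [f s], and continuity in one variable
    suffices. *)
Lemma ratio_near (c rho : R) :
  0 < c -> 0 < rho ->
  exists d, 0 < d /\ d < c /\ forall y z z',
    Rabs (y - c) < d -> Rabs (z - c) < d -> Rabs (z' - c) < d ->
    Rabs (y / (z * z') - / c) < rho.
Proof.
intros Hc Hrho.
set (f := fun s => (c + s) / ((c - s) * (c - s))).
assert (f0 : f 0 = / c) by (unfold f; field; lra).
assert (Cf : continuous f 0).
{ apply ex_derive_continuous_R; unfold f; auto_derive.
  replace (c + - 0) with c by ring; apply Rgt_not_eq; nra. }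
destruct (continuous_near f 0 rho Cf Hrho) as [d [Hd Hf]].
rewrite f0 in Hf.
exists (Rmin d c / 2).
pose proof (Rmin_l d c); pose proof (Rmin_r d c).
assert (Hm : 0 < Rmin d c) by (apply Rmin_pos; lra).
set (s := Rmin d c / 2).
assert (Hs : 0 < s /\ s < d /\ s < c) by (unfold s; lra).
split; [lra|split; [lra|]]; intros y z z' Hy Hz Hz'.
apply Rabs_def2 in Hy; apply Rabs_def2 in Hz; apply Rabs_def2 in Hz'.
pose proof (Hf s ltac:(rewrite Rminus_0_r, Rabs_pos_eq; lra)) as F1.
pose proof (Hf (- s) ltac:(rewrite Rminus_0_r, Rabs_Ropp, Rabs_pos_eq; lra)) as F2.
apply Rabs_def2 in F1; apply Rabs_def2 in F2.
assert (B1 : y / (z * z') <= f s).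
{ unfold f, Rdiv; apply Rmult_le_compat; [lra| |lra|].
  - left; apply Rinv_0_lt_compat, Rmult_lt_0_compat; lra.
  - apply Rinv_le_contravar; [apply Rmult_lt_0_compat; lra|].
    apply Rmult_le_compat; lra. }
assert (B2 : f (- s) <= y / (z * z')).
{ unfold f, Rdiv; apply Rmult_le_compat; [lra| |lra|].
  - left; apply Rinv_0_lt_compat, Rmult_lt_0_compat; lra.
  - apply Rinv_le_contravar; [apply Rmult_lt_0_compat; lra|].
    apply Rmult_le_compat; lra. }
apply Rabs_def1; lra.
Qed.

(* The vertical distance of a point to the graph is multiplied by about
   [|1 / c + l1| = l2 < 1] under [T]. *)
Lemma backward_orbit_on_graph (alpha beta l1 l2 c eta : R) (omega : R -> R) :
  0 < c -> 0 < l2 < 1 -> c * (l1 + l2) = -1 -> 0 < eta ->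
  smooth_on (fun x => Rabs (x - c) < eta) omega ->
  omega c = c -> is_derive omega c l1 ->
  (forall x, Rabs (x - c) < eta ->
     rhs alpha beta x (omega x) = omega (omega x)) ->
  exists k, 0 < k /\ k < c /\
    forall u : nat -> R * R,
      (forall n, T alpha beta (u (S n)) = u n) ->
      (forall n, Rabs (fst (u n) - c) < k /\ Rabs (snd (u n) - c) < k) ->
      snd (u 0%nat) = omega (fst (u 0%nat)).
Proof.
intros Hc H2 Hs Heta Som om0 Dom Hinv.
destruct (Som 2%nat) as [om' [Hom' [om'' [Hom'' _]]]].
assert (Hcc : Rabs (c - c) < eta) by (rewrite Rminus_diag, Rabs_R0; exact Heta).
assert (E' : om' c = l1).
{ rewrite <- (is_derive_unique _ _ _ Dom); symmetry; apply is_derive_unique.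
  apply Hom', Hcc. }
(* The errors in omega' and in the ratio are each below [rho], and l2 + 2 rho = (1 + l2) / 2 < 1 is
   the contraction factor. *)
set (rho := (1 - l2) / 4).
assert (Hrho : 0 < rho) by (unfold rho; lra).
destruct (continuous_near om' c rho) as [d1 [Hd1 Hn1]];
  [apply ex_derive_continuous_R; eexists; apply Hom'', Hcc|exact Hrho|].
rewrite E' in Hn1.
destruct (ratio_near c rho Hc Hrho) as [d2 [Hd2 [Hd2c Hn2]]].
set (d := Rmin eta (Rmin d1 d2)).
assert (Hd : 0 < d /\ d <= eta /\ d <= d1 /\ d <= d2).
{ pose proof (Rmin_l eta (Rmin d1 d2)); pose proof (Rmin_r eta (Rmin d1 d2)).
  pose proof (Rmin_l d1 d2); pose proof (Rmin_r d1 d2); fold d in H, H0.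
  repeat split; try lra; unfold d; repeat apply Rmin_pos; lra. }
destruct (continuous_near omega c d) as [d3 [Hd3 Hn3]];
  [apply ex_derive_continuous_R; eexists; apply Dom|lra|].
rewrite om0 in Hn3.
(* For a point of the box, its coordinates and the graph value above its abscissa are all within [d]
   of [c]. *)
set (k := Rmin d d3 / 2).
assert (Hk : 0 < k /\ k < d /\ k < d3).
{ pose proof (Rmin_l d d3); pose proof (Rmin_r d d3).
  assert (0 < Rmin d d3) by (apply Rmin_pos; lra); unfold k; lra. }
exists k; split; [lra|split; [lra|]]; intros u Hu Hbox.
apply Rminus_diag_uniq.
apply (backward_contraction_zero
  (fun n => snd (u n) - omega (fst (u n))) ((1 + l2) / 2) (2 * d)); [lra| |].
- intros n; pose proof (Hu n) as Hun; pose proof (Hbox n) as Bn.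
  pose proof (Hbox (S n)) as [By Bz].
  destruct (u (S n)) as [y z]; unfold T in Hun; simpl in *; rewrite <- Hun in *.
  simpl in *.
  set (z' := omega y).
  assert (Bz' : Rabs (z' - c) < d) by (apply Hn3; lra).
  assert (Eom : omega z' = rhs alpha beta y z') by (symmetry; apply Hinv; lra).
  destruct (MVT_gen omega z' z om') as [xi [Hxi Exi]].
  { intros x Hx; apply Hom'.
    apply Rabs_def2 in Bz; apply Rabs_def2 in Bz'.
    pose proof (Rmin_glb_lt z' z (c - d) ltac:(lra) ltac:(lra)).
    pose proof (Rmax_lub_lt z' z (c + d) ltac:(lra) ltac:(lra)).
    apply Rabs_def1; lra. }
  { intros x Hx; apply continuity_pt_filterlim, ex_derive_continuous_R.
    exists (om' x); apply Hom'.
    apply Rabs_def2 in Bz; apply Rabs_def2 in Bz'.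
    pose proof (Rmin_glb_lt z' z (c - d) ltac:(lra) ltac:(lra)).
    pose proof (Rmax_lub_lt z' z (c + d) ltac:(lra) ltac:(lra)).
    apply Rabs_def1; lra. }
  assert (Bxi : Rabs (xi - c) < d).
  { apply Rabs_def2 in Bz; apply Rabs_def2 in Bz'.
    pose proof (Rmin_glb_lt z' z (c - d) ltac:(lra) ltac:(lra)).
    pose proof (Rmax_lub_lt z' z (c + d) ltac:(lra) ltac:(lra)).
    apply Rabs_def1; lra. }
  pose proof (Hn1 xi ltac:(lra)) as C1.
  pose proof (Hn2 y z z' ltac:(lra) ltac:(lra) ltac:(lra)) as C2.
  assert (Pz : 0 < z) by (apply Rabs_def2 in Bz; lra).
  assert (Pz' : 0 < z') by (apply Rabs_def2 in Bz'; lra).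
  (* Invariance gives omega z' = rhs y z', so the new vertical distance is (y / z - y / z') - (omega
     z - omega z'), and z - z' factors out. *)
  replace (rhs alpha beta y z - omega z)
    with (- (y / (z * z') + om' xi) * (z - z')).
  + rewrite Rabs_mult, Rabs_Ropp.
    apply Rmult_le_compat_r; [apply Rabs_pos|].
    assert (Ec : / c + l1 = - l2).
    { apply (Rmult_eq_reg_l c); [|lra].
      rewrite Rmult_plus_distr_l, Rinv_r by lra; lra. }
    apply Rabs_def2 in C1; apply Rabs_def2 in C2; unfold rho in C1, C2.
    apply Rabs_le; lra.
  + replace (omega z) with (omega z' + om' xi * (z - z')) by lra.
    rewrite Eom; unfold rhs; field; lra.
- intros n; destruct (Hbox n) as [B1 B2].
  pose proof (Hn3 (fst (u n)) ltac:(lra)) as B3.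
  apply Rabs_def2 in B2; apply Rabs_def2 in B3; apply Rabs_le; lra.
Qed.

(** Dividing the parameter by [l1] inverts [T] along the curve; as |l1| > 1, the parameters shrink
    to 0 and the orbit stays in [N]. *)
Lemma backward_orbit_exists (alpha beta l1 c r : R) (g : R -> R) :
  l1 < -1 -> 0 < r -> continuous g 0 -> g 0 = c ->
  (forall t, Rabs t < r -> g (l1 ^ 2 * t) * g (l1 * t) =
     (alpha + beta * g t) * g (l1 * t) + g t) ->
  forall N : R * R -> Prop,
    locally (c, c) N -> (forall q, N q -> quadrant q) ->
    exists d, 0 < d /\ forall t, Rabs t < d ->
      local_unstable (T alpha beta) (c, c) N (g t, g (l1 * t)).
Proof.
intros H1 Hr Cg g0 Hg N [e He] Hquad.
assert (Habs : Rabs l1 = - l1) by (apply Rabs_left; lra).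
assert (Hin : forall eps : posreal, exists d, 0 < d /\ forall t, Rabs t < d ->
          ball (c, c) eps (g t, g (l1 * t))).
{ intros eps; destruct (continuous_near g 0 eps Cg (cond_pos eps))
    as [d [Hd Hn]]; rewrite g0 in Hn.
  (* This radius controls both coordinates, since |t| <= |l1 t| < d. *)
  exists (d / - l1); split; [apply Rdiv_lt_0_compat; lra|]; intros t Ht.
  assert (Hlt : Rabs (l1 * t) < d).
  { rewrite Rabs_mult, Habs; apply (Rmult_lt_compat_l (- l1)) in Ht; [|lra].
    replace (- l1 * (d / - l1)) with d in Ht by (field; lra); exact Ht. }
  assert (Ht' : Rabs t < d).
  { apply Rle_lt_trans with (2 := Hlt); rewrite Rabs_mult, Habs.
    rewrite <- (Rmult_1_l (Rabs t)) at 1.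
    apply Rmult_le_compat_r; [apply Rabs_pos|lra]. }
  split; [apply (Hn t)|apply (Hn (l1 * t))]; now rewrite Rminus_0_r. }
destruct (Hin e) as [d [Hd HN]].
exists (Rmin d r); split; [now apply Rmin_pos|]; intros t Ht.
pose proof (Rmin_l d r); pose proof (Rmin_r d r).
set (s := fun n : nat => (/ l1) ^ n * t).
assert (Hinv : Rabs (/ l1) < 1).
{ rewrite Rabs_inv, Habs, <- Rinv_1; apply Rinv_lt_contravar; lra. }
assert (Hs : forall n, Rabs (s n) <= Rabs t).
{ intros n; unfold s; rewrite Rabs_mult, <- RPow_abs.
  rewrite <- (Rmult_1_l (Rabs t)) at 2.
  apply Rmult_le_compat_r; [apply Rabs_pos|].
  rewrite <- (pow1 n); apply pow_incr; split; [apply Rabs_pos|lra]. }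
assert (Hss : forall n, l1 * s (S n) = s n)
  by (intros n; unfold s; simpl; field; lra).
assert (HNs : forall n, N (g (s n), g (l1 * s n))).
{ intros n; apply He, HN; pose proof (Hs n); lra. }
split; [apply He, HN; lra|].
exists (fun n => (g (s n), g (l1 * s n))); repeat split.
- unfold s; simpl; now rewrite Rmult_1_l.
- intros n; unfold T, rhs; simpl.
  pose proof (Hquad _ (HNs (S n))) as [_ Hpos]; simpl in Hpos.
  pose proof (Hg (s (S n)) ltac:(pose proof (Hs (S n)); lra)) as E.
  replace (l1 ^ 2 * s (S n)) with (l1 * (l1 * s (S n))) in E by ring.
  rewrite Hss in *; f_equal.
  apply (Rmult_eq_reg_r (g (s n))); [|lra].
  rewrite E; field; lra.
- exact HNs.
- intros P [eps HP].
  destruct (Hin eps) as [d' [Hd' HN']].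
  destruct (pow_lt_1_zero (/ l1) Hinv (d' / (Rabs t + 1))) as [n0 Hn0].
  { pose proof (Rabs_pos t); apply Rdiv_lt_0_compat; lra. }
  exists n0; intros n Hn; apply HP, HN'.
  specialize (Hn0 n Hn); unfold s; rewrite Rabs_mult.
  pose proof (Rabs_pos t); pose proof (Rabs_pos ((/ l1) ^ n)).
  apply (Rmult_lt_compat_r (Rabs t + 1)) in Hn0; [|lra].
  unfold Rdiv in Hn0; rewrite (Rmult_assoc d'), Rinv_l in Hn0 by lra; lra.
Qed.

(** [N0] is the box on which backward orbits are forced onto the graph, so it serves every smaller
    [N]. Conversely, graph points close enough to the fixed point, how close depending on [N], have
    backward orbits inside [N]. *)
Lemma unstable_graph (alpha beta : R) :
  0 < alpha < 1 -> 0 <= beta < 1 ->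
  let c := xbar alpha beta in
  exists omega : R -> R,
    smooth_near omega c /\ omega c = c /\
    (exists N0 : R * R -> Prop,
       locally (pbar alpha beta) N0 /\
       (forall q, N0 q -> quadrant q) /\
       forall N : R * R -> Prop,
         locally (pbar alpha beta) N ->
         (forall q, N q -> N0 q) ->
         locally (pbar alpha beta) (fun q =>
           local_unstable (T alpha beta) (pbar alpha beta) N q <->
           snd q = omega (fst q))) /\
    exists K, locally c (fun x =>
      Rabs (U alpha beta x (omega x)) <= K * Rabs (x - c) ^ 4).
Proof.
intros Ha Hb c.
destruct (eigenvalue_facts alpha beta Ha Hb)
  as (Hc & _ & H1 & H2 & Hs & _ & _).
destruct (unstable_parametrization alpha beta Ha Hb)
  as (g & e & Sg & g0 & Dg & He & Eg & K & dK & HdK & HK).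
fold c in Hc, Hs, g0; set (l1 := lambda1 alpha beta) in *.
assert (Habs : Rabs l1 = - l1) by (apply Rabs_left; lra).
assert (Hm2 : - l1 < l1 ^ 2) by (simpl; nra).
set (r := / l1 ^ 2).
assert (Hr : 0 < r) by (apply Rinv_0_lt_compat; lra).
assert (Hrl : l1 ^ 2 * r = 1) by (apply Rinv_r; lra).
assert (Hr1 : r < 1) by (unfold r; rewrite <- Rinv_1; apply Rinv_lt_contravar; lra).
assert (Hl1r : forall t, Rabs t < r -> Rabs (l1 * t) < 1).
{ intros t Ht; rewrite Rabs_mult, Habs.
  apply Rle_lt_trans with (l1 ^ 2 * Rabs t).
  - apply Rmult_le_compat_r; [apply Rabs_pos|lra].
  - rewrite <- Hrl; apply Rmult_lt_compat_l; lra. }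
assert (Eg' : forall t, Rabs t < r -> g (l1 ^ 2 * t) * g (l1 * t) =
     (alpha + beta * g t) * g (l1 * t) + g t).
{ intros t Ht; apply Eg; rewrite Rabs_mult, (Rabs_pos_eq (l1 ^ 2)) by lra.
  rewrite <- Hrl; apply Rmult_lt_compat_l; lra. }
destruct (local_inverse g r e Hr
  (fun n => Ck_subset _ _ n g (fun t Ht => Rlt_trans _ _ _ Ht Hr1) (Sg n)) Dg He)
  as (d & eta & L & G & Hd & Heta & HL & HGg & HgG & SG).
rewrite g0 in HgG, SG.
set (omega := fun x => g (l1 * G x)).
assert (Som : smooth_on (fun x => Rabs (x - c) < eta) omega).
{ intros n; apply (Ck_comp _ (fun t => Rabs t < 1) n g (fun x => l1 * G x));
    [|apply Sg|].
  - intros x Hx; destruct (HgG x Hx) as (Gx & _ & _); apply Hl1r; lra.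
  - apply Ck_mult; [apply Ck_const|apply SG]. }
assert (Hconj : forall t, Rabs t < d -> omega (g t) = g (l1 * t)).
{ intros t Ht; unfold omega; now rewrite HGg. }
assert (Gc : G c = 0) by (rewrite <- g0; apply HGg; rewrite Rabs_R0; lra).
assert (omc : omega c = c) by (unfold omega; now rewrite Gc, Rmult_0_r).
assert (Hcc : Rabs (c - c) < eta) by (rewrite Rminus_diag, Rabs_R0; exact Heta).
(* Differentiating [omega (g t) = g (l1 * t)] at 0 gives e v = l1 e, with e > 0. *)
assert (Dom : is_derive omega c l1).
{ destruct (smooth_on_ex_derive _ _ c Som Hcc) as [v Hv].
  assert (D1 : is_derive (fun t => omega (g t)) 0 (e * v)).
  { apply (is_derive_comp omega g 0 v e); [rewrite g0; exact Hv|exact Dg]. }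
  assert (D2 : is_derive (fun t => g (l1 * t)) 0 (l1 * e)).
  { apply (is_derive_comp g (fun t => l1 * t) 0 e l1);
      [rewrite Rmult_0_r; exact Dg|].
    auto_derive; [exact I|ring]. }
  assert (D3 : is_derive (fun t => g (l1 * t)) 0 (e * v)).
  { apply (is_derive_ext_loc (fun t => omega (g t))); [|exact D1].
    exists (mkposreal d (proj1 Hd)); intros t Ht; apply Hconj.
    change (Rabs (t - 0) < d) in Ht; now rewrite Rminus_0_r in Ht. }
  replace l1 with v; [exact Hv|].
  apply (Rmult_eq_reg_l e); [|lra].
  rewrite <- (is_derive_unique _ _ _ D3), (is_derive_unique _ _ _ D2); ring. }
exists omega; split; [|split; [exact omc|split]].
- apply (smooth_on_near c eta); assumption.
(* Within [eta1] of [c] one has |l1 G(x)| < d, so [Hconj] applies at [l1 * G x] and yields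
   invariance of the graph. *)
- destruct (continuous_near G c (d / - l1)) as [eta1 [Heta1 HG1]];
    [apply ex_derive_continuous_R, (smooth_on_ex_derive _ _ c SG Hcc)
    |apply Rdiv_lt_0_compat; lra|].
  rewrite Gc in HG1.
  set (eta2 := Rmin eta eta1).
  destruct (continuous_near omega c c) as [eta3 [Heta3 Hom3]];
    [apply ex_derive_continuous_R; eexists; apply Dom|exact Hc|].
  rewrite omc in Hom3.
  set (eta4 := Rmin eta2 eta3).
  assert (Heta4 : 0 < eta4 /\ eta4 <= eta /\ eta4 <= eta1 /\ eta4 <= eta3).
  { pose proof (Rmin_l eta eta1); pose proof (Rmin_r eta eta1).
    pose proof (Rmin_l eta2 eta3); pose proof (Rmin_r eta2 eta3).
    fold eta2 in H, H0; fold eta4 in H3, H4.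
    split; [|lra]; unfold eta4, eta2; repeat apply Rmin_pos; lra. }
  assert (Hinv : forall x, Rabs (x - c) < eta4 ->
            rhs alpha beta x (omega x) = omega (omega x)).
  { intros x Hx.
    destruct (HgG x ltac:(lra)) as (Gx & Ex & _).
    pose proof (HG1 x ltac:(lra)) as Gx1; rewrite Rminus_0_r in Gx1.
    assert (Hpos : 0 < omega x).
    { pose proof (Hom3 x ltac:(lra)) as B; apply Rabs_def2 in B; lra. }
    assert (Hlt : Rabs (l1 * G x) < d).
    { rewrite Rabs_mult, Habs; apply (Rmult_lt_compat_l (- l1)) in Gx1; [|lra].
      replace (- l1 * (d / - l1)) with d in Gx1 by (field; lra); exact Gx1. }
    change (omega (omega x)) with (omega (g (l1 * G x))).
    rewrite (Hconj _ Hlt).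
    pose proof (Eg' (G x) ltac:(lra)) as E; rewrite Ex in E.
    fold (omega x) in E.
    replace (l1 * (l1 * G x)) with (l1 ^ 2 * G x) by ring.
    apply (Rmult_eq_reg_r (omega x)); [|lra].
    rewrite E; unfold rhs; field; lra. }
  destruct (backward_orbit_on_graph alpha beta l1 _ c eta4 omega Hc H2 Hs
    (proj1 Heta4)
    (fun n => Ck_subset _ _ n omega
       (fun x Hx => Rlt_le_trans _ _ _ Hx (proj1 (proj2 Heta4))) (Som n))
    omc Dom Hinv) as (k & Hk & Hkc & Horb).
  unfold pbar; fold c.
  exists (fun q => Rabs (fst q - c) < k /\ Rabs (snd q - c) < k).
  split; [|split].
  + exists (mkposreal k Hk); intros q Hq; exact Hq.
  + intros q [B1 B2]; apply Rabs_def2 in B1; apply Rabs_def2 in B2.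
    split; lra.
  + intros N HN HN0.
    destruct (backward_orbit_exists alpha beta l1 c r g H1 Hr) with (N := N)
      as [dN [HdN Hex]]; try assumption.
    { apply ex_derive_continuous_R; exists e; exact Dg. }
    { intros q Nq; destruct (HN0 q Nq) as [B1 B2].
      apply Rabs_def2 in B1; apply Rabs_def2 in B2; split; lra. }
    destruct (continuous_near G c dN) as [etaN [HetaN HGN]];
      [apply ex_derive_continuous_R, (smooth_on_ex_derive _ _ c SG Hcc)
      |exact HdN|].
    rewrite Gc in HGN.
    assert (Hm : 0 < Rmin eta etaN) by (apply Rmin_pos; lra).
    exists (mkposreal _ Hm); intros [x y] [Hx _].
    change (Rabs (x - c) < Rmin eta etaN) in Hx.
    pose proof (Rmin_l eta etaN); pose proof (Rmin_r eta etaN).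
    simpl; split.
    * intros [_ [u (u0 & HT & HNu & _)]].
      pose proof (Horb u HT (fun n => HN0 _ (HNu n))) as E.
      rewrite u0 in E; exact E.
    * intros ->.
      destruct (HgG x ltac:(lra)) as (_ & Ex & _).
      pose proof (HGN x ltac:(lra)) as B; rewrite Rminus_0_r in B.
      pose proof (Hex _ B) as E; rewrite Ex in E; exact E.
(* The bound |G(x)| <= L |x - c| converts order four in the parameter into order four in x - c; the
   radius [dK / L] keeps [G x] within [dK]. *)
- set (dx := Rmin eta (dK / L)).
  assert (Hdx : 0 < dx) by (apply Rmin_pos; [lra|apply Rdiv_lt_0_compat; lra]).
  exists (Rabs K * L ^ 4), (mkposreal dx Hdx); intros x Hx.
  change (Rabs (x - c) < dx) in Hx.
  pose proof (Rmin_l eta (dK / L)); pose proof (Rmin_r eta (dK / L)).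
  fold dx in H, H0.
  destruct (HgG x ltac:(lra)) as (_ & Ex & Lx).
  assert (Ht : Rabs (G x) < dK).
  { apply Rle_lt_trans with (1 := Lx).
    apply Rlt_le_trans with (L * (dK / L)); [|right; field; lra].
    apply Rmult_lt_compat_l; lra. }
  pose proof (HK (G x) Ht) as B; rewrite Ex in B; fold (omega x) in B.
  apply (Rle_trans _ _ _ B).
  apply Rle_trans with (Rabs K * Rabs (G x) ^ 4).
  { apply Rmult_le_compat_r; [apply pow_le, Rabs_pos|apply Rle_abs]. }
  rewrite Rmult_assoc, <- Rpow_mult_distr.
  apply Rmult_le_compat_l; [apply Rabs_pos|].
  apply pow_incr; split; [apply Rabs_pos|exact Lx].
Qed.

(** * From the residual to the distance between the graphs *)

(** The divided difference of [U] in its second variable, between omega and phi, is - Phi, where Phi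
    is continuous at c with value gamma2 > 0. Near c the residual of omega is thus at least gamma2 /
    2 times |omega - phi|. *)
Lemma contact_from_residual (alpha beta K : R) (phi omega : R -> R) :
  0 < alpha < 1 -> 0 <= beta < 1 ->
  let c := xbar alpha beta in
  smooth_near omega c -> omega c = c -> U_solution alpha beta phi ->
  locally c (fun x => Rabs (U alpha beta x (omega x)) <= K * Rabs (x - c) ^ 4) ->
  exists C, locally c (fun x =>
    Rabs (omega x - phi x) <= C * Rabs (x - c) ^ 4).
Proof.
intros Ha Hb c Som omc (Sphi & phic & HU) HK.
destruct (eigenvalue_facts alpha beta Ha Hb) as (_ & _ & H1 & H2 & _).
destruct (gamma_eq alpha beta Ha Hb) as (_ & G2 & _).
assert (Pg2 : 0 < gamma2 alpha beta) by (rewrite G2; apply Rdiv_lt_0_compat; lra).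
fold c in phic, HU, Sphi.
set (g1 := gamma1 alpha beta) in *; set (g2 := gamma2 alpha beta) in *.
set (g3 := gamma3 alpha beta) in *.
set (A := a2 alpha beta) in *; set (B := a3 alpha beta) in *.
set (w := fun y x => g1 * (x - c) + g3 * (y - c)).
set (Phi := fun x => g2 - A * g3 * (w (omega x) x + w (phi x) x)
  - B * g3 * (w (omega x) x ^ 2 + w (omega x) x * w (phi x) x + w (phi x) x ^ 2)).
assert (Phic : Phi c = g2) by (unfold Phi, w; rewrite omc, phic; ring).
assert (CPhi : continuous Phi c).
{ apply ex_derive_continuous_R.
  assert (D1 : ex_derive omega c) by exact (locally_singleton _ _ Som 1%nat).
  assert (D2 : ex_derive phi c) by exact (locally_singleton _ _ Sphi 1%nat).
  unfold Phi, w; auto_derive; repeat split; assumption. }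
assert (HPhi : locally c (fun x => g2 / 2 < Phi x)).
{ apply (CPhi (fun y => g2 / 2 < y)); rewrite Phic; apply (open_gt (g2 / 2)); lra. }
exists (2 / g2 * K).
generalize (filter_and _ _ HPhi (filter_and _ _ HU HK)).
apply filter_imp; intros x (BP & EU & BK).
assert (E : U alpha beta x (omega x) = - (omega x - phi x) * Phi x).
{ rewrite <- (Rminus_0_r (U alpha beta x (omega x))), <- EU.
  unfold U; fold c g1 g2 g3 A B; unfold Phi, w; ring. }
rewrite E, Rabs_mult, Rabs_Ropp, (Rabs_pos_eq (Phi x)) in BK by lra.
assert (B2 : Rabs (omega x - phi x) * (g2 / 2)
             <= K * Rabs (x - c) ^ 4).
{ apply Rle_trans with (2 := BK), Rmult_le_compat_l; [apply Rabs_pos|lra]. }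
apply (Rmult_le_compat_l (2 / g2)) in B2; [|left; apply Rdiv_lt_0_compat; lra].
replace (2 / g2 * (Rabs (omega x - phi x) * (g2 / 2)))
  with (Rabs (omega x - phi x)) in B2 by (field; lra).
lra.
Qed.

Theorem theorem2p1 (alpha beta : R)
    (halpha : 0 < alpha < 1) (hbeta : 0 <= beta < 1) :
  exists phi : R -> R,
    U_solution alpha beta phi /\
    (forall psi : R -> R, U_solution alpha beta psi ->
       locally (xbar alpha beta) (fun x => psi x = phi x)) /\
    exists omega : R -> R,
      smooth_near omega (xbar alpha beta) /\
      (exists N0 : R * R -> Prop,
         locally (pbar alpha beta) N0 /\
         (forall q, N0 q -> quadrant q) /\
         forall N : R * R -> Prop,
           locally (pbar alpha beta) N ->
           (forall q, N q -> N0 q) ->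
           locally (pbar alpha beta) (fun q =>
             local_unstable (T alpha beta) (pbar alpha beta) N q <->
             snd q = omega (fst q))) /\
      exists C : R,
        locally (xbar alpha beta) (fun x =>
          Rabs (omega x - phi x) <= C * Rabs (x - xbar alpha beta) ^ 4).
Proof.
destruct (implicit_solution alpha beta halpha hbeta) as (phi & Hphi & Huniq).
destruct (unstable_graph alpha beta halpha hbeta)
  as (omega & Som & omc & HN0 & K & HK).
exists phi; split; [exact Hphi|split; [exact Huniq|]].
exists omega; split; [exact Som|split; [exact HN0|]].
exact (contact_from_residual alpha beta K phi omega halpha hbeta Som omc Hphi HK).
Qed.
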